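(* Let $n\ge2$ and let $B$ and $H$ satisfy the standing assumptions listed in the context, with $\beta\in(0,1)$. Then: 1. Assumption (A) is equivalent to assumption (A)$'$. 2. Assumption (B) is equivalent to assumption (B)$'$. Here: (A) There exist $p>1$, $\kappa\in[0,1)$ and $\gamma,\Gamma>0$ such that for any $\xi\in\mathbb{R}^n\setminus\{0\}$, $\zeta\in\mathbb{R}^n$, $$[\mathrm{Hess}(B\circ H)(\xi)]_{ij}\zeta_i\zeta_j\ge\gamma(\kappa+|\xi|)^{p-2}|\zeta|^2,\qquad \sum_{i,j=1}^n\big|[\mathrm{Hess}(B\circ H)(\xi)]_{ij}\big|\le\Gamma(\kappa+|\xi|)^{p-2}.$$ (A)$'$ There exist $p>1$, $\bar\kappa\in[0,1)$ and $\bar\gamma,\bar\Gamma,\lambda>0$ such that $H$ is uniformly elliptic with constant $\lambda$ and, for any $t>0$, $$\bar\gamma(\bar\kappa+t)^{p-2}t\le B'(t)\le\bar\Gamma(\bar\kappa+t)^{p-2}t,\qquad \bar\gamma(\bar\kappa+t)^{p-2}\le B''(t)\le\bar\Gamma(\bar\kappa+t)^{p-2}.$$ (B) $B\circ H\in C^{3,\beta}_{\rm loc}(\mathbb{R}^n)$ and for any $K>0$ there exists $\gamma>0$ such that, for any $\xi,\zeta\in\mathbb{R}^n$ with $|\xi|\le K$, $$[\mathrm{Hess}(B\circ H)(\xi)]_{ij}\zeta_i\zeta_j\ge\gamma|\zeta|^2.$$ (B)$'$ $B\in C^{3,\beta}_{\rm loc}([0,+\infty))$ with $B'''(0)=0$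 and $B''(0)>0$, and there is a symmetric positive definite real $n\times n$ matrix $M$ such that $H(\xi)=\sqrt{\langle M\xi,\xi\rangle}$ for all $\xi\in\mathbb{R}^n$.
   Context: Repeated indices are summed; $H_{ij}=\partial_{ij}H$; $\mathrm{Hess}$ denotes the Hessian matrix. Standing assumptions: $B\in C^{3,\beta}_{\rm loc}((0,+\infty))\cap C^1([0,+\infty))$, $B(0)=B'(0)=0$, and $B(t),B'(t),B''(t)>0$ for all $t>0$; $H\in C^{3,\beta}_{\rm loc}(\mathbb{R}^n\setminus\{0\})$ is positive homogeneous of degree $1$ ($H(t\xi)=tH(\xi)$ for $t>0$, $\xi\ne0$), $H(\xi)>0$ for $\xi\neq0$, and $H(0):=0$. $H$ is uniformly elliptic with constant $\lambda>0$ if $H_{ij}(\xi)\zeta_i\zeta_j\ge\lambda|\zeta|^2$ for any $\xi$ with $H(\xi)=1$ and any $\zeta\in\nabla H(\xi)^\perp$. *)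

(* Defs.v *)
From HB Require Import structures.
From mathcomp Require Import all_boot all_order all_algebra.
From mathcomp Require Import all_classical all_reals all_analysis.

Set Implicit Arguments.
Unset Strict Implicit.
Unset Printing Implicit Defensive.

Import Order.TTheory GRing.Theory Num.Theory.
Import numFieldNormedType.Exports.

Local Open Scope ring_scope.
Local Open Scope classical_set_scope.

(* The library norm on ['rV[R]_n] is the sup norm, so the Euclidean structure
   is defined separately. *)
Definition dotv (R : realType) (n : nat) (u v : 'rV[R]_n) : R :=
  \sum_i u 0 i * v 0 i.

Definition enorm (R : realType) (n : nat) (u : 'rV[R]_n) : R :=
  Num.sqrt (dotv u u).

(* A_ij z_i z_j, that is <A z, z>. *)
Definition qform (R : realType) (n : nat) (A : 'M[R]_n) (z : 'rV[R]_n) : R :=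
  \sum_i \sum_j A i j * z 0 i * z 0 j.

Definition posdefmx (R : realType) (n : nat) (A : 'M[R]_n) : Prop :=
  A^T = A /\ forall z : 'rV[R]_n, z != 0 -> 0 < qform A z.

(* The norm is the library one; in ['rV[R]_n] replacing it by the Euclidean
   norm only changes the constant [C]. *)
Definition holder_loc (R : realType) (V : normedModType R) (beta : R)
    (D : set V) (g : V -> R) : Prop :=
  forall K : set V, compact K -> K `<=` D ->
    exists C : R, forall x y : V, K x -> K y ->
      `|g x - g y| <= C * `|x - y| `^ beta.

Definition partial (R : realType) (n : nat) (i : 'I_n) (f : 'rV[R]_n -> R)
    : 'rV[R]_n -> R :=
  fun x => 'D_(delta_mx 0 i) f x.

Definition partials (R : realType) (n : nat) (s : seq 'I_n)
    (f : 'rV[R]_n -> R) : 'rV[R]_n -> R :=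
  foldr (@partial R n) f s.

Definition grad (R : realType) (n : nat) (f : 'rV[R]_n -> R)
    (x : 'rV[R]_n) : 'rV[R]_n :=
  \row_i partial i f x.

Definition hess (R : realType) (n : nat) (f : 'rV[R]_n -> R)
    (x : 'rV[R]_n) : 'M[R]_n :=
  \matrix_(i, j) partial i (partial j f) x.

(* [D] is meant to be open. *)
Definition Ck (R : realType) (n k : nat) (D : set 'rV[R]_n)
    (f : 'rV[R]_n -> R) : Prop :=
  (forall (s : seq 'I_n) (i : 'I_n) (x : 'rV[R]_n), (size s < k)%N -> D x ->
     derivable (partials s f) x (delta_mx 0 i)) /\
  (forall (s : seq 'I_n) (x : 'rV[R]_n), (size s <= k)%N -> D x ->
     {for x, continuous (partials s f)}).

Definition Ckholder_loc (R : realType) (n k : nat) (beta : R)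
    (D : set 'rV[R]_n) (f : 'rV[R]_n -> R) : Prop :=
  Ck k D f /\
  forall s : seq 'I_n, size s = k -> holder_loc beta D (partials s f).

(* Derivative relative to an interval [D], one-sided at the endpoints of [D]:
   for [t] in [D] it only depends on the values of [f] on [D]. It agrees with
   [derive1] at interior points ([derive1_inE] below). *)
Definition diffquot_in (R : realType) (D : set R) (f : R -> R) (t : R) :=
  h^-1 * (f (h + t) - f t) @[h --> within [set h | D (h + t)] 0^'].

Definition derivable_in (R : realType) (D : set R) (f : R -> R) (t : R)
    : Prop :=
  cvg (diffquot_in D f t).

Definition derive1_in (R : realType) (D : set R) (f : R -> R) (t : R) : R :=
  lim (diffquot_in D f t).

Definition derive1n_in (R : realType) (D : set R) (k : nat) (f : R -> R)
    : R -> R :=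
  iter k (derive1_in D) f.

Definition Ck_in (R : realType) (k : nat) (D : set R) (f : R -> R) : Prop :=
  (forall (j : nat) (t : R), (j < k)%N -> D t ->
     derivable_in D (derive1n_in D j f) t) /\
  (forall j : nat, (j <= k)%N -> {within D, continuous (derive1n_in D j f)}).

Definition Ckholder_loc_in (R : realType) (k : nat) (beta : R) (D : set R)
    (f : R -> R) : Prop :=
  Ck_in k D f /\ holder_loc (V := R) beta D (derive1n_in D k f).

Lemma derive1_inE (R : realType) (D : set R) (f : R -> R) (t : R) :
  open D -> D t -> derive1_in D f t = f^`() t.
Proof.
move=> oD Dt; rewrite /derive1_in /diffquot_in derive1E /derive.
suff -> : within [set h | D (h + t)] 0^' = 0^'.
  suff -> : (fun h => h^-1 * (f (h + t) - f t)) =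
            (fun h => h^-1 *: (f (h *: 1 + t) - f t)) by [].
  by apply/funext => h; rewrite /GRing.scale/= mulr1.
have Dn : \forall h \near 0^', D (h + t).
  have : (fun h : R => h + t) @ 0^' --> t.
    rewrite -[X in _ --> X]add0r; apply: cvgD; last exact: cvg_cst.
    exact: nbhs_dnbhs.
  by apply; exact: open_nbhs_nbhs.
apply/seteqP; split => A; rewrite /within /=.
  by move=> DA; apply: filterS2 Dn DA => h Dh; apply.
by apply: filterS => h Ah _.
Qed.

(* The profile [B] lives on [0, +oo[; its values at negative reals play no
   role. *)
Definition B_standing (R : realType) (beta : R) (B : R -> R) : Prop :=
  [/\ Ckholder_loc_in 3 beta `]0, +oo[ B,
      Ck_in 1 `[0, +oo[ B,
      B 0 = 0,
      derive1_in `[0, +oo[ B 0 = 0 &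
      forall t : R, 0 < t -> [/\ 0 < B t, 0 < B^`() t & 0 < B^`(2) t]].

Definition H_standing (R : realType) (n : nat) (beta : R)
    (H : 'rV[R]_n -> R) : Prop :=
  [/\ Ckholder_loc 3 beta [set xi | xi != 0] H,
      forall (t : R) (xi : 'rV[R]_n), 0 < t -> xi != 0 ->
        H (t *: xi) = t * H xi,
      forall xi : 'rV[R]_n, xi != 0 -> 0 < H xi &
      H 0 = 0].

Definition unif_elliptic (R : realType) (n : nat) (lambda : R)
    (H : 'rV[R]_n -> R) : Prop :=
  forall xi zeta : 'rV[R]_n, H xi = 1 -> dotv (grad H xi) zeta = 0 ->
    lambda * enorm zeta ^+ 2 <= qform (hess H xi) zeta.

Definition assumption_A (R : realType) (n : nat) (B : R -> R)
    (H : 'rV[R]_n -> R) : Prop :=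
  exists p kappa gamma Gamma : R,
    [/\ 1 < p, 0 <= kappa < 1, 0 < gamma, 0 < Gamma &
      forall xi zeta : 'rV[R]_n, xi != 0 ->
        gamma * (kappa + enorm xi) `^ (p - 2) * enorm zeta ^+ 2
          <= qform (hess (B \o H) xi) zeta /\
        \sum_i \sum_j `|hess (B \o H) xi i j|
          <= Gamma * (kappa + enorm xi) `^ (p - 2)].

Definition assumption_A' (R : realType) (n : nat) (B : R -> R)
    (H : 'rV[R]_n -> R) : Prop :=
  exists p kappa gamma Gamma lambda : R,
    [/\ 1 < p, 0 <= kappa < 1, [/\ 0 < gamma, 0 < Gamma & 0 < lambda],
      unif_elliptic lambda H &
      forall t : R, 0 < t ->
        gamma * (kappa + t) `^ (p - 2) * t <= B^`() t
          <= Gamma * (kappa + t) `^ (p - 2) * t /\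
        gamma * (kappa + t) `^ (p - 2) <= B^`(2) t
          <= Gamma * (kappa + t) `^ (p - 2)].

Definition assumption_B (R : realType) (n : nat) (beta : R) (B : R -> R)
    (H : 'rV[R]_n -> R) : Prop :=
  Ckholder_loc 3 beta setT (B \o H) /\
  forall K : R, 0 < K -> exists gamma : R, 0 < gamma /\
    forall xi zeta : 'rV[R]_n, enorm xi <= K ->
      gamma * enorm zeta ^+ 2 <= qform (hess (B \o H) xi) zeta.

Definition assumption_B' (R : realType) (n : nat) (beta : R) (B : R -> R)
    (H : 'rV[R]_n -> R) : Prop :=
  [/\ Ckholder_loc_in 3 beta `[0, +oo[ B,
      derive1n_in `[0, +oo[ 3 B 0 = 0,
      0 < derive1n_in `[0, +oo[ 2 B 0 &
      exists M : 'M[R]_n, posdefmx M /\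
        forall xi : 'rV[R]_n, H xi = Num.sqrt (qform M xi)].

(* Main.v *)
From mathcomp Require Import all_boot all_order all_algebra.
From mathcomp Require Import all_classical all_reals all_analysis.
From mathcomp Require Import ring lra zify.
Require Import Defs.

(** Write F for the composition of B and H. Off the origin
      Hess F = B''(H) grad H (grad H)^T + B'(H) Hess H,
    and Euler's relations <grad H(x), x> = H(x), x Hess H(x) = 0 and
    Hess H(x) x = 0 ([euler_H], [euler_hessH_l], [euler_hessH_r]) make this form
    block diagonal for the splitting z = a x + e with <grad H(x), e> = 0: it is
    B''(H) (a H)^2 in the radial direction and B'(H) <Hess H(x) e, e> in the
    directions tangent to the level sets of H.

    (A) and (A)'. The bounds in (A)' are bounds on these two blocks, while |x| / H(x),
    the entries of grad H and those of |x| Hess H are controlled by compactness of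
    the unit sphere; this gives [assumption_A'_A]. Conversely ([assumption_A_A']),
    one tests (A) on a fixed ray: the radial direction returns the bounds on B'',
    one fixed tangential direction, available as n >= 2, returns those on B'(t) / t,
    and all tangential directions at the level H = 1 return the uniform
    ellipticity of H.

    (B) implies (B)' ([assumption_B_B']). For t > 0 one has
    <Hess F(t x) x, x> = B''(t H(x)) H(x)^2. Letting t tend to 0 gives
    <Hess F(0) x, x> = B''(0) H(x)^2, so H^2 is a positive definite quadratic form.
    Hence H is even, and restricting F to a line through 0 yields an even function
    of class C^{3,beta} which extends B; its third derivative vanishes at 0.

    (B)' implies (B) ([assumption_B'_B]). Now grad H = u with u(x) = M x / H(x), and
    with r(t) = B'(t) / t and d = r' = (B'' - r) / t the derivatives of F are
      F_i   = r(H) (M x)_i,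
      F_ij  = (B'' - r)(H) u_i u_j + r(H) M_ij,
      F_kij = B'''(H) u_k u_i u_j
              + d(H) (M_ki u_j + M_kj u_i + M_ij u_k - 3 u_k u_i u_j).
    Since B'(0) = B'''(0) = 0 and B''' is beta-Hoelder, Taylor's formula at 0
    gives d(t) = O(t^beta), and d is beta-Hoelder ([defect_holder]). The functions
    u_i are bounded, and |u(x) - u(y)| is at most a constant times |x - y| / H(y);
    this singularity is compensated by the factors B'''(H) and d(H), which vanish
    at the origin like H^beta ([radial_angular_holder]). So F_kij extends by 0 to a
    locally Hoelder function, and the estimates near 0 show that the three formulas
    remain valid at the origin. Ellipticity follows from
      <Hess F z, z> = B''(H) <u, z>^2 + r(H) (<M z, z> - <u, z>^2)
    and the Cauchy-Schwarz inequality <u, z>^2 <= <M z, z>. *)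

Set Implicit Arguments.
Unset Strict Implicit.
Unset Printing Implicit Defensive.

Import Order.TTheory GRing.Theory Num.Theory.
Import numFieldNormedType.Exports.

Local Open Scope ring_scope.
Local Open Scope classical_set_scope.

(** * Derivatives along lines *)

Lemma is_deriveP (R : realType) (V : normedModType R) (f : V -> R) (x v : V)
    (d : R) :
  is_derive x v f d <->
  h^-1 * (f (h *: v + x) - f x) @[h --> 0^'] --> d.
Proof.
split=> [[df <-]|fd]; first exact: df.
by split; [apply/cvg_ex; exists d; exact: fd | exact: cvg_lim fd].
Qed.

(** Differentiating [f] along [v] is differentiating a function of one real
    variable; this is how one-variable theorems are applied to directional
    derivatives. *)
Lemma is_derive_line (R : realType) (V : normedModType R) (f : V -> R)
    (x v : V) (s d : R) :
  is_derive (s *: v + x) v f d <-> is_derive s 1 (fun h : R => f (h *: v + x)) d.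
Proof.
rewrite !is_deriveP.
suff -> : (fun h => h^-1 * (f (h *: v + (s *: v + x)) - f (s *: v + x))) =
    (fun h => h^-1 * (f ((h *: 1 + s) *: v + x) - f (s *: v + x))) by [].
by apply/funext => h; rewrite [h *: 1]mulr1 scalerDl addrA.
Qed.

Lemma is_derive_line0 (R : realType) (V : normedModType R) (f : V -> R)
    (x v : V) (d : R) :
  is_derive x v f d <-> is_derive (0 : R) 1 (fun h : R => f (h *: v + x)) d.
Proof. by rewrite -is_derive_line scale0r add0r. Qed.

(** The chain rule for functions of one variable, applied to the restriction of
    [f] to the line directed by [v]. *)
Lemma is_derive_compR (R : realType) (V : normedModType R) (g : R -> R)
    (f : V -> R) (x v : V) (d e : R) :
  is_derive x v f d -> is_derive (f x) 1 g e -> is_derive x v (g \o f) (e * d).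
Proof.
move=> /is_derive_line0 df dg.
apply/is_derive_line0; set l := fun h => f _ in df.
have l0 : l 0 = f x by rewrite /l scale0r add0r.
rewrite -l0 in dg.
case: (df) => df1 df2; case: (dg) => dg1 dg2.
split.
  apply/(derivable1_diffP (g \o l)); apply: differentiable_comp.
    by move/derivable1_diffP: df1.
  by move/derivable1_diffP: dg1.
by rewrite -derive1E -df2 -dg2 -!derive1E; exact: (derive1_comp df1 dg1).
Qed.

(** Stated for the derivative of the rescaled function, this turns the
    homogeneity of a function into the homogeneity of its derivatives. *)
Lemma is_derive_scale (R : realType) (V : normedModType R) (f : V -> R)
    (x v : V) (t d : R) :
  t != 0 -> is_derive x v (fun y => f (t *: y)) d ->
  is_derive (t *: x) v f (t^-1 * d).
Proof.
move=> t0 H; have df := (is_derive_line0 _ _ _ _).1 H.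
apply: (is_derive_line0 _ _ _ _).2.
have -> : (fun h => f (h *: v + t *: x)) =
    (fun h : R => f (t *: (h *: v + x))) \o (fun h => t^-1 * h).
  by apply/funext => h /=; rewrite scalerDr !scalerA mulVKf.
rewrite mulrC; apply: is_derive_compR; last by rewrite mulr0.
by apply: is_derive_eq; rewrite [_ *: 1]mulr1.
Qed.

(** The sign of [a] is arbitrary: the increments below are [h * c] with [h]
    tending to 0 from both sides. *)
Lemma MVT_sym (R : realType) (g dg : R -> R) (a : R) :
  (forall s : R, `|s| <= `|a| -> is_derive s 1 g (dg s)) ->
  exists2 c, `|c| <= `|a| & g a - g 0 = dg c * a.
Proof.
move=> gd.
have main (f df : R -> R) (b : R) : 0 <= b ->
    (forall s : R, `|s| <= b -> is_derive s 1 f (df s)) ->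
    exists2 c, `|c| <= b & f b - f 0 = df c * b.
  move=> b0 fd; have [||c cb fc] := @MVT_segment R f df 0 b b0.
  - move=> x; rewrite in_itv /= => /andP[x0 xb]; apply: fd.
    by rewrite gtr0_norm // ltW.
  - apply: derivable_within_continuous => x; rewrite in_itv /= => /andP[x0 xb].
    by have [] := fd x _; rewrite ?ger0_norm.
  - move: cb; rewrite in_itv /= => /andP[c0 cb].
    by exists c; rewrite ?ger0_norm // fc subr0.
have [a0|a0] := leP 0 a.
  by rewrite (ger0_norm a0) in gd *; exact: main.
have [||c ca e] := main (g \o -%R) (fun s => - dg (- s)) (- a).
- by rewrite oppr_ge0 ltW.
- move=> s; rewrite -(ltr0_norm a0) -mulrN1 => sa.
  by apply: is_derive_compR; apply: gd; rewrite normrN.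
exists (- c); first by rewrite normrN (le_trans ca) // ltr0_norm.
by move: e; rewrite /= opprK oppr0 => ->; rewrite mulrNN.
Qed.

(** * Functions with continuous partial derivatives *)

Lemma near_neq0 (R : realType) (V : normedModType R) (x : V) :
  x != 0 -> \forall y \near x, y != 0.
Proof.
move=> x0; have n0 : 0 < `|x| by rewrite normr_gt0.
near=> y; apply/negP => /eqP y0.
have : `|x - y| < `|x| by near: y; exact: cvgr_dist_lt.
by rewrite y0 subr0 ltxx.
Unshelve. all: by end_near. Qed.

(** By the mean value theorem the increment equals [h * c] times the value of
    [g] at a point which tends to [x] with [h]; the base point [h *: u + x] of
    the increment may itself move. *)
Lemma increment_along (R : realType) (V : normedModType R) (f g : V -> R)
    (x u e : V) (c : R) :
  (\forall y \near x, is_derive y e f (g y)) -> {for x, continuous g} ->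
  h^-1 * (f (h *: (c *: e + u) + x) - f (h *: u + x)) @[h --> 0^'] --> c * g x.
Proof.
move=> fg gc; apply/cvgrPdist_le => /= eps eps0.
have c1 : 0 < `|c| + 1 by rewrite ltr_wpDl.
have : \forall y \near x, is_derive y e f (g y) /\
    `|g x - g y| <= eps / (`|c| + 1).
  apply: filterI; first exact: fg.
  by move/cvgrPdist_le : gc; apply; rewrite divr_gt0.
move=> /nbhs_ballP [d /= d0 dP].
(* [|h| * M] bounds the distance to [x] of every point met by the increment. *)
pose M := `|u| + `|c| * `|e| + 1.
have M0 : 0 < M by rewrite /M ltr_wpDl // addr_ge0 // mulr_ge0.
have near_x (h s : R) : `|h| < d / M -> `|s| <= `|h * c| ->
    ball x d (s *: e + (h *: u + x)).
  move=> hd sh; rewrite -ball_normE /ball_ /= addrA opprD addrCA subrr addr0.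
  rewrite normrN (le_lt_trans (ler_normD _ _)) // !normrZ.
  apply: (@le_lt_trans _ _ (`|h| * M)); last by rewrite -ltr_pdivlMr.
  rewrite /M mulrDr mulr1 mulrDr mulrA -normrM.
  rewrite -[leLHS]addr0 lerD // addrC lerD //.
  by rewrite ler_wpM2r.
near=> h.
have h0 : h != 0 by near: h; exact: nbhs_dnbhs_neq.
have hd : `|h| < d / M.
  by near: h; apply: dnbhs0_lt; rewrite divr_gt0.
have [s sh e1] := @MVT_sym R (fun s => f (s *: e + (h *: u + x)))
  (fun s => g (s *: e + (h *: u + x))) (h * c)
  (fun s sh => (is_derive_line _ _ _ _ _).1 (dP _ (near_x _ _ hd sh)).1).
have -> : f (h *: (c *: e + u) + x) - f (h *: u + x) =
    g (s *: e + (h *: u + x)) * (h * c).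
  by rewrite -e1 scale0r add0r scalerDr scalerA -addrA.
have -> : h^-1 * (g (s *: e + (h *: u + x)) * (h * c)) =
  c * g (s *: e + (h *: u + x)) by field.
rewrite -mulrBr normrM.
apply: (@le_trans _ _ ((`|c| + 1) * (eps / (`|c| + 1)))); last first.
  by rewrite mulrC divfK // gt_eqF.
by rewrite ler_pM ?lerDl //; apply: (dP _ (near_x _ _ hd sh)).2.
Unshelve. all: by end_near. Qed.

(** The path from [x] to [h *: v + x] is replaced by a chain of segments
    parallel to the axes; each segment contributes one partial derivative in
    the limit by [increment_along]. *)
Lemma is_derive_partials (R : realType) (n : nat) (f : 'rV[R]_n -> R)
    (g : 'I_n -> 'rV[R]_n -> R) (x v : 'rV[R]_n) :
  (forall i, \forall y \near x, is_derive y (delta_mx 0 i) f (g i y)) ->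
  (forall i, {for x, continuous (g i)}) ->
  is_derive x v f (\sum_i v 0 i * g i x).
Proof.
move=> fg gc; apply/is_deriveP.
have sumP (s : seq 'I_n) : h^-1 * (f (h *: (\sum_(i <- s)
    v 0 i *: delta_mx 0 i) + x) - f x) @[h --> 0^'] -->
    \sum_(i <- s) v 0 i * g i x.
  elim: s => [|i s IH].
    rewrite !big_nil; apply: cvg_near_cst; near=> h.
    by rewrite scaler0 add0r subrr mulr0.
  rewrite !big_cons; set w := \sum_(i <- s) _ in IH *.
  rewrite (_ : (fun h => _) = (fun h => h^-1 *
    (f (h *: (v 0 i *: delta_mx 0 i + w) + x) - f (h *: w + x)) +
    h^-1 * (f (h *: w + x) - f x))); last first.
    by apply/funext => h; rewrite -[RHS]mulrDr addrA addrNK.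
  apply: cvgD; last exact: IH.
  exact: increment_along (fg i) (gc i).
rewrite {1}(row_sum_delta v); exact: sumP.
Unshelve. all: by end_near. Qed.

(** Euler's identity, from the derivative at [h = 0] of [f ((h + 1) *: x) = (h
    + 1) ^+ k * f x]. It is used for degrees 1 (the function H) and 0 (its
    first derivatives). *)
Lemma is_derive_euler (R : realType) (V : normedModType R) (f : V -> R)
    (k : nat) (x : V) (d : R) :
  (forall (t : R) y, 0 < t -> y != 0 -> f (t *: y) = t ^+ k * f y) ->
  x != 0 -> is_derive x x f d -> d = k%:R * f x.
Proof.
move=> fk x0 /is_derive_line0 fd.
have fd' : is_derive (0 : R) 1 (fun h : R => (h + 1) ^+ k * f x) d.
  apply: near_eq_is_derive fd; near=> h.
  rewrite -{2}[x]scale1r -scalerDl fk //.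
  have : `|h| < 1 by near: h; exact: (@nbhs0_lt _ R 1).
  by rewrite ltr_norml => /andP[h1 _]; rewrite -ltrBlDr sub0r.
have fk' : is_derive (0 : R) 1 (fun h : R => (h + 1) ^+ k * f x) (k%:R * f x).
  rewrite (_ : (fun h => _) = (shift 1 : R -> R) ^+ k * cst (f x)).
    apply: is_derive_eq.
    rewrite scaler0 add0r addr0 /= add0r expr1n mulr1.
    by rewrite [_ *: 1]mulr1 [_ *: _]mulrC.
  by apply/funext => h; rewrite -[RHS]/((_ ^+ _) h * f x) exprfctE.
by case: fd' => _ <-; case: fk' => _ <-.
Unshelve. all: by end_near. Qed.

Lemma Ck_is_derive (R : realType) (n k : nat) (D : set 'rV[R]_n)
    (f : 'rV[R]_n -> R) (s : seq 'I_n) (i : 'I_n) (x : 'rV[R]_n) :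
  Ck k D f -> (size s < k)%N -> D x ->
  is_derive x (delta_mx 0 i) (partials s f) (partials (i :: s) f x).
Proof. by move=> [fd _] sk Dx; apply: derivableP; apply: fd. Qed.

Lemma is_derive_coord (R : realType) (n : nat) (x v : 'rV[R]_n) (j : 'I_n) :
  is_derive x v (fun y : 'rV[R]_n => y 0 j) (v 0 j).
Proof.
apply/is_deriveP; apply: cvg_near_cst; near=> h.
rewrite !mxE addrK mulKf //; near: h; exact: nbhs_dnbhs_neq.
Unshelve. all: by end_near. Qed.

(** * One-sided derivatives on the half-line *)

Lemma diffquot_in_nbhs (R : realType) (D : set R) (f : R -> R) (t : R) :
  nbhs t D ->
  diffquot_in D f t = h^-1 * (f (h *: 1 + t) - f t) @[h --> 0^'].
Proof.
move=> Dt; rewrite /diffquot_in.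
have Dn : \forall h \near 0^', D (h + t).
  have : (fun h : R => h + t) @ 0^' --> t.
    rewrite -[X in _ --> X]add0r; apply: cvgD; last exact: cvg_cst.
    exact: nbhs_dnbhs.
  exact.
have -> : within [set h | D (h + t)] 0^' = 0^'.
  apply/seteqP; split => A; rewrite /within /=.
    by move=> DA; apply: filterS2 Dn DA => h Dh; apply.
  by apply: filterS => h Ah _.
by under [in RHS]eq_fun do rewrite [_ *: 1]mulr1.
Qed.

Lemma derive1_in_nbhs (R : realType) (D : set R) (f : R -> R) (t : R) :
  nbhs t D -> derive1_in D f t = f^`() t.
Proof. by move=> Dt; rewrite /derive1_in diffquot_in_nbhs // derive1E. Qed.

Lemma derivable_in_nbhs (R : realType) (D : set R) (f : R -> R) (t : R) :
  nbhs t D -> derivable_in D f t -> derivable f t 1.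
Proof. by move=> Dt; rewrite /derivable_in diffquot_in_nbhs. Qed.

(** At an interior point the iterated relative derivatives only see a
    neighbourhood, where they are ordinary derivatives. *)
Lemma derive1n_in_nbhs (R : realType) (D : set R) (f : R -> R) (k : nat)
    (t : R) :
  nbhs t D -> derive1n_in D k f t = f^`(k) t.
Proof.
elim: k t => [//|k IH] t Dt.
rewrite -[LHS]/(derive1_in D (derive1n_in D k f) t) (derive1_in_nbhs _ Dt).
rewrite derive1nS !derive1E; apply: near_eq_derive.
by have := nbhs_interior Dt; apply: filterS => y /IH.
Qed.

Lemma Ck_in_is_derive (R : realType) (D : set R) (f : R -> R) (k j : nat)
    (t : R) :
  Ck_in k D f -> (j < k)%N -> nbhs t D -> is_derive t 1 f^`(j) (f^`(j.+1) t).
Proof.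
move=> [fd _] jk Dt; rewrite derive1nS derive1E; apply: derivableP.
apply: near_eq_derivable (derivable_in_nbhs Dt (fd j t jk (nbhs_singleton Dt))).
by have := nbhs_interior Dt; apply: filterS => y; exact: derive1n_in_nbhs.
Qed.

Lemma nbhs_pos (R : realType) (t : R) : 0 < t -> nbhs t `]0, +oo[%classic.
Proof.
by move=> t0; apply: filterS (lt_nbhsr t0) => y y0; rewrite /= in_itv /= andbT.
Qed.

Lemma nbhs_nneg (R : realType) (t : R) : 0 < t -> nbhs t `[0, +oo[%classic.
Proof.
by move=> t0; apply: filterS (lt_nbhsr t0) => y y0;
  rewrite /= in_itv /= andbT ltW.
Qed.

(** Limits of difference quotients relative to the half-line are unique,
    including at its endpoint. *)
Lemma diffquot_in_half_line_proper (R : realType) (t : R) : 0 <= t ->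
  ProperFilter (within [set h | `[0, +oo[%classic (h + t)] (0 : R)^').
Proof.
move=> t0; apply: Build_ProperFilter_ex => A /nbhs_ballP[e /= e0 eA].
have e20 : 0 < e / 2 by rewrite divr_gt0.
exists (e / 2); apply: eA.
- by rewrite /ball /= sub0r normrN gtr0_norm // ltr_pdivrMr // ltr_pMr // ltr1n.
- by rewrite gt_eqF.
- by rewrite /= in_itv /= andbT addr_ge0 // ltW.
Qed.

(** Relative derivatives are computed from any differentiable extension. *)
Lemma diffquot_in_eq (R : realType) (D : set R) (f g : R -> R) (t d : R) :
  (forall s, D s -> f s = g s) -> D t -> is_derive t 1 g d ->
  diffquot_in D f t --> d.
Proof.
move=> fg Dt /is_deriveP gd.
have {}gd : h^-1 * (g (h + t) - g t) @[h --> within [set h | D (h + t)] 0^'] --> d.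
  apply: cvg_within_filter.
  by under eq_fun do rewrite -[X in _ * (g (X + _) - _)]mulr1.
apply: cvg_trans gd; apply: near_eq_cvg; rewrite near_withinE; apply: nearW.
by move=> h /= Dh; rewrite !fg.
Qed.

Lemma derive1n_in_eq (R : realType) (f : R -> R) (g : nat -> R -> R) (k : nat) :
  (forall t : R, 0 <= t -> f t = g 0%N t) ->
  (forall j (t : R), (j < k)%N -> is_derive t 1 (g j) (g j.+1 t)) ->
  forall j t, (j <= k)%N -> 0 <= t -> derive1n_in `[0, +oo[ j f t = g j t.
Proof.
move=> fg gd; elim=> [|j IH] t jk t0; first exact: fg.
have PF := diffquot_in_half_line_proper t0.
apply: (@cvg_lim _ _ _ _ PF) => //.
apply: (@diffquot_in_eq _ _ _ (g j)); last exact: gd.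
  by move=> s; rewrite /= in_itv /= andbT; apply: IH; exact: ltnW.
by rewrite /= in_itv /= andbT.
Qed.

(** A function which extends to a function of class C^k on the line is of class
    C^k on the half-line. *)
Lemma Ck_in_eq (R : realType) (f : R -> R) (g : nat -> R -> R) (k : nat) :
  (forall t : R, 0 <= t -> f t = g 0%N t) ->
  (forall j (t : R), (j < k)%N -> is_derive t 1 (g j) (g j.+1 t)) ->
  continuous (g k) -> Ck_in k `[0, +oo[ f.
Proof.
move=> fg gd gc; have fgj := derive1n_in_eq fg gd.
split=> [j t jk Dt|j jk].
  apply/cvg_ex; exists (g j.+1 t); apply: (@diffquot_in_eq _ _ _ (g j)) => //.
    by move=> s; rewrite /= in_itv /= andbT; apply: fgj; exact: ltnW.
  exact: gd.
have cg : continuous (g j).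
  move: jk; rewrite leq_eqVlt => /predU1P[->//|jk] t.
  by apply: differentiable_continuous; apply/derivable1_diffP; have [] := gd j t jk.
apply: (@subspace_eq_continuous _ _ _ (g j)); last exact: continuous_subspaceT.
by move=> t; rewrite inE /= in_itv /= andbT => t0; apply: esym; exact: fgj.
Qed.

Lemma continuous_at0_eq0 (R : realType) (f : R -> R) :
  {for 0, continuous f} -> (forall t : R, 0 < t -> f t = 0) -> f 0 = 0.
Proof.
move=> fc f0; have /cvg_lim <- // : f @ (0 : R)^'+ --> f 0.
  by apply: cvg_at_right_filter; exact: fc.
apply: (@cvg_lim _ _ _ _ _ _ (0 : R)) => //; apply: cvg_near_cst.
by near=> t; apply: f0; near: t; exact: nbhs_right_gt.
Unshelve. all: by end_near. Qed.

(** * Quadratic forms and the Euclidean norm *)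

Lemma qformE (R : realType) (n : nat) (A : 'M[R]_n) (z : 'rV[R]_n) :
  qform A z = (z *m A *m z^T) 0 0.
Proof.
rewrite mxE /qform exchange_big; apply: eq_bigr => j _.
by rewrite !mxE mulr_suml; apply: eq_bigr => i _; ring.
Qed.

Lemma dotvE (R : realType) (n : nat) (u v : 'rV[R]_n) :
  dotv u v = (u *m v^T) 0 0.
Proof. by rewrite mxE; apply: eq_bigr => i _; rewrite mxE. Qed.

Lemma dotvDr (R : realType) (n : nat) (u v w : 'rV[R]_n) :
  dotv u (v + w) = dotv u v + dotv u w.
Proof. by rewrite !dotvE linearD /= mulmxDr mxE. Qed.

Lemma dotvZr (R : realType) (n : nat) (u v : 'rV[R]_n) (a : R) :
  dotv u (a *: v) = a * dotv u v.
Proof. by rewrite !dotvE linearZ /= -scalemxAr mxE. Qed.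

Lemma dotvC (R : realType) (n : nat) (u v : 'rV[R]_n) : dotv u v = dotv v u.
Proof. by apply: eq_bigr => i _; rewrite mulrC. Qed.

Lemma qformZ (R : realType) (n : nat) (A : 'M[R]_n) (a : R) (z : 'rV[R]_n) :
  qform A (a *: z) = a ^+ 2 * qform A z.
Proof.
by rewrite !qformE linearZ /= -scalemxAl -scalemxAr -scalemxAl scalerA mxE.
Qed.

(** A vector in both the left and the right kernel does not contribute to the
    form. This will be applied to a Hessian, whose two kernels are computed in
    [euler_hessH_l] and [euler_hessH_r]. *)
Lemma qform_degenerate (R : realType) (n : nat) (A : 'M[R]_n) (x z : 'rV[R]_n)
    (a : R) :
  x *m A = 0 -> A *m x^T = 0 -> qform A (a *: x + z) = qform A z.
Proof.
move=> xA Ax; rewrite !qformE linearD linearZ /= mulmxDl -scalemxAl xA.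
by rewrite scaler0 add0r mulmxDr -mulmxA -scalemxAr Ax scaler0 mulmx0 add0r.
Qed.

Lemma sqr_enorm (R : realType) (n : nat) (z : 'rV[R]_n) :
  enorm z ^+ 2 = dotv z z.
Proof. by rewrite sqr_sqrtr // sumr_ge0 // => i _; rewrite -expr2 sqr_ge0. Qed.

Lemma enorm_ge0 (R : realType) (n : nat) (z : 'rV[R]_n) : 0 <= enorm z.
Proof. exact: sqrtr_ge0. Qed.

Lemma enormZ (R : realType) (n : nat) (a : R) (z : 'rV[R]_n) :
  enorm (a *: z) = `|a| * enorm z.
Proof.
apply/eqP; rewrite -(@eqrXn2 _ 2) ?enorm_ge0 ?mulr_ge0 ?enorm_ge0 //.
by rewrite exprMn !sqr_enorm dotvZr dotvC dotvZr mulrA -expr2 real_normK ?num_real.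
Qed.

Lemma ler_coord_norm (R : realType) (n : nat) (x : 'rV[R]_n) (i : 'I_n) :
  `|x 0 i| <= `|x|.
Proof.
by rewrite [leRHS]/Num.norm /= mx_normrE; apply/bigmax_geP; right; exists (0, i).
Qed.

Lemma ler_norm_enorm (R : realType) (n : nat) (x : 'rV[R]_n) :
  `|x| <= enorm x.
Proof.
have [->|x0] := eqVneq x 0; first by rewrite normr0 enorm_ge0.
have [[j i] /= e] : exists i, mx_norm x = `|x i.1 i.2|.
  by apply: mx_norm_neq0; apply: contra x0 => /eqP/mx_norm_eq0 ->.
rewrite [leLHS]/Num.norm /= e (ord1 j) -(@ler_pXn2r _ 2) ?nnegrE ?enorm_ge0 //.
rewrite sqr_enorm real_normK ?num_real // /dotv (bigD1 i) //= -expr2 lerDl.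
by rewrite sumr_ge0 // => k _; rewrite -expr2 sqr_ge0.
Qed.

Lemma ler_enorm_norm (R : realType) (n : nat) (x : 'rV[R]_n) :
  enorm x <= n.+1%:R * `|x|.
Proof.
rewrite -(@ler_pXn2r _ 2) ?nnegrE ?mulr_ge0 ?enorm_ge0 //.
rewrite sqr_enorm exprMn; apply: (@le_trans _ _ (\sum_(i < n) `|x| ^+ 2)).
  apply: ler_sum => i _; rewrite -expr2 -[leLHS]real_normK ?num_real //.
  by rewrite ler_pXn2r ?nnegrE // ler_coord_norm.
rewrite sumr_const card_ord -[leLHS]mulr_natl ler_wpM2r ?sqr_ge0 //.
rewrite -natrX ler_nat; lia.
Qed.

(** The unit sphere of the sup norm is compact, so a finite family of functions
    continuous off the origin has a common bound on it; homogeneity then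
    carries such bounds to the whole space. *)
Lemma bounded_on_sphere (R : realType) (n : nat) (I : finType)
    (g : I -> 'rV[R]_n -> R) :
  (forall i x, x != 0 -> {for x, continuous (g i)}) ->
  exists2 C : R, 0 < C & forall i x, `|x| = 1 -> `|g i x| <= C.
Proof.
move=> gc; pose S : set 'rV[R]_n := [set x | `|x| = 1].
have Sc : compact S.
  apply: bounded_closed_compact.
    by exists 1; split; rewrite ?num_real // => M M1 x /= ->; exact: ltW.
  rewrite (_ : S = Num.norm @^-1` [set 1]); last by [].
  apply: closed_comp => [x _|]; [exact: norm_continuous|exact: closed_eq].
have bnd i : exists C : R, forall x, `|x| = 1 -> `|g i x| <= C.
  have /compact_bounded [M [_ MP]] : compact (g i @` S).
    apply: continuous_compact Sc; apply: continuous_in_subspaceT => x.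
    rewrite inE /S /= => x1; apply: gc.
    by rewrite -normr_gt0 x1.
  exists (M + 1) => x x1; apply: (MP (M + 1)); first by rewrite ltrDl.
  by exists x.
have [C CP] := choice bnd.
exists (1 + \sum_i `|C i|); first by rewrite ltr_pwDl // sumr_ge0.
move=> i x x1; rewrite (le_trans (CP i x x1)) // (bigD1 i) //=.
have := ler_norm (C i).
have : 0 <= \sum_(j | j != i) `|C j| by rewrite sumr_ge0.
lra.
Qed.

Lemma sqr_enormD (R : realType) (n : nat) (u v : 'rV[R]_n) :
  enorm (u + v) ^+ 2 <= 2 * (enorm u ^+ 2 + enorm v ^+ 2).
Proof.
rewrite !sqr_enorm /dotv -big_split mulr_sumr /=; apply: ler_sum => i _.
rewrite mxE; move: (u 0 i) (v 0 i) => a b.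
have := sqr_ge0 (a - b); nra.
Qed.

Lemma enorm_gt0 (R : realType) (n : nat) (z : 'rV[R]_n) : z != 0 -> 0 < enorm z.
Proof.
by move=> z0; apply: lt_le_trans (ler_norm_enorm z); rewrite normr_gt0.
Qed.

Lemma qform_ler (R : realType) (n : nat) (A : 'M[R]_n) (z : 'rV[R]_n) :
  qform A z <= (\sum_i \sum_j `|A i j|) * enorm z ^+ 2.
Proof.
rewrite mulr_suml; apply: ler_sum => i _; rewrite mulr_suml; apply: ler_sum => j _.
apply: le_trans (ler_norm _) _; rewrite !normrM -mulrA.
apply: ler_wpM2l => //; rewrite expr2.
by apply: ler_pM => //; apply: le_trans (ler_norm_enorm z); exact: ler_coord_norm.
Qed.

Lemma delta_neq0 (R : realType) (n : nat) (i : 'I_n) :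
  delta_mx 0 i != 0 :> 'rV[R]_n.
Proof.
by apply/eqP => /rowP/(_ i); rewrite !mxE !eqxx => /eqP; rewrite oner_eq0.
Qed.

Lemma norm_scale_unit (R : realType) (n : nat) (x : 'rV[R]_n) : x != 0 ->
  exists2 y, `|y| = 1 & x = `|x| *: y.
Proof.
move=> x0; exists (`|x|^-1 *: x).
  by rewrite normrZ normfV normr_id mulVf // normr_eq0.
by rewrite scalerA divff ?scale1r // normr_eq0.
Qed.

(** * Comparing powers *)

(** The exponent [q] will be [p - 2], which is negative for [p < 2]; each of
    the two comparisons serves one sign. *)
Lemma powR_comparable (R : realType) (M a b q : R) :
  1 <= M -> 0 < a -> 0 < b -> a <= M * b -> b <= M * a ->
  b `^ q <= M `^ `|q| * a `^ q.
Proof.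
move=> M1 a0 b0 ab ba; have M0 : 0 <= M by rewrite (le_trans ler01).
have a0' := ltW a0; have b0' := ltW b0.
have [q0|q0] := leP 0 q.
  by rewrite ger0_norm // -powRM // ge0_ler_powR ?nnegrE ?mulr_ge0.
rewrite ltr0_norm // -[X in b `^ X]opprK -[X in a `^ X]opprK !(powRN _ (- q)).
rewrite ler_pdivlMr ?powR_gt0 // mulrC ler_pdivrMr ?powR_gt0 //.
rewrite -powRM // ge0_ler_powR ?nnegrE ?mulr_ge0 //.
by rewrite oppr_ge0 ltW.
Qed.

Lemma powR_shift_comparable (R : realType) (M k s t q : R) :
  1 <= M -> 0 <= k -> 0 < s -> 0 < t -> s <= M * t -> t <= M * s ->
  (k + t) `^ q <= M `^ `|q| * (k + s) `^ q.
Proof.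
move=> M1 k0 s0 t0 st ts.
have kM : k <= M * k by rewrite ler_peMl.
apply: powR_comparable => //; rewrite ?ltr_wpDl //; rewrite mulrDr.
all: exact: lerD.
Qed.

(** Interpolation between [X <= A] and [X <= A * (d / s)]: for [d <= s] one
    uses [d / s <= (d / s) `^ beta], otherwise [s `^ beta <= d `^ beta]. This
    turns a Lipschitz bound degenerating at scale [s] into a Hoelder bound. *)
Lemma powR_interpolation (R : realType) (beta s d A X : R) :
  0 < beta <= 1 -> 0 < s -> 0 <= d -> 0 <= X -> X <= A -> X <= A * (d / s) ->
  s `^ beta * X <= A * d `^ beta.
Proof.
move=> /andP[b0 b1] s0 d0 X0 XA XAd; have A0 := le_trans X0 XA.
have [sd|ds] := leP s d.
  rewrite mulrC; apply: ler_pM => //; first exact: powR_ge0.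
  by apply: ge0_ler_powR; rewrite ?nnegrE // ltW.
move: d0; rewrite le_eqVlt => /predU1P[d0|d0].
  rewrite -d0 mul0r mulr0 in XAd.
  have -> : X = 0 by apply/eqP; rewrite eq_le XAd X0.
  by rewrite mulr0 mulr_ge0 ?powR_ge0.
have x0 : 0 < d / s by rewrite divr_gt0.
apply: (@le_trans _ _ (s `^ beta * (A * (d / s)))).
  by rewrite ler_wpM2l // powR_ge0.
rewrite mulrCA ler_wpM2l //.
apply: (@le_trans _ _ (s `^ beta * (d / s) `^ beta)).
  rewrite ler_wpM2l ?powR_ge0 //; apply: ger1_powR => //.
  by rewrite x0 /= ler_pdivrMr // mul1r ltW.
by rewrite -powRM ?(ltW s0) ?(ltW x0) // [s * _]mulrC divfK ?gt_eqF.
Qed.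

(** [N] will be the norm H, in which the estimates below are written. *)
Lemma continuous_of_modulus (R : realType) (V : normedModType R) (N f : V -> R)
    (x : V) (L C b : R) :
  0 < L -> (forall y, 0 <= N y <= L * `|y|) -> 0 < b ->
  (forall y, N (x - y) <= 1 -> `|f x - f y| <= C * N (x - y) `^ b) ->
  {for x, continuous f}.
Proof.
move=> L0 NP b0 fP; apply/cvgrPdist_le => /= eps eps0.
have C1 : 0 < `|C| + 1 by rewrite ltr_wpDl.
have e1 : 0 < eps / (`|C| + 1) by rewrite divr_gt0.
(* [d] is at most 1 and satisfies [(|C| + 1) * d `^ b <= eps]. *)
pose d := Num.min 1 ((eps / (`|C| + 1)) `^ b^-1).
have d0 : 0 < d by rewrite lt_min ltr01 powR_gt0.
near=> y.
have : N (x - y) <= d.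
  have /andP[_ h] := NP (x - y); apply: (le_trans h).
  rewrite -ler_pdivlMl //; near: y.
  by apply: cvgr_dist_le => //; rewrite mulr_gt0 // invr_gt0.
rewrite le_min => /andP[h1 hd]; apply: (le_trans (fP y h1)).
apply: (@le_trans _ _ ((`|C| + 1) * N (x - y) `^ b)).
  by rewrite ler_wpM2r ?powR_ge0 //; have := ler_norm C; lra.
rewrite mulrC -ler_pdivlMr //.
rewrite -[leRHS](powRr1 (ltW e1)) -[X in _ <= _ `^ X](mulVf (lt0r_neq0 b0)) powRrM.
have /andP[N0 _] := NP (x - y).
by apply: ge0_ler_powR; rewrite ?nnegrE ?powR_ge0 // ltW.
Unshelve. all: by end_near. Qed.

(** * Positively homogeneous functions *)

Section Homogeneous.
Variables (R : realType) (n : nat) (beta : R) (H : 'rV[R]_n -> R).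
Hypothesis hH : H_standing beta H.
Implicit Types x z : 'rV[R]_n.

Lemma H_gt0 x : x != 0 -> 0 < H x.
Proof. by case: hH => _ _ + _; apply. Qed.

Lemma H_ge0 x : 0 <= H x.
Proof.
have [->|/H_gt0/ltW //] := eqVneq x 0.
by case: hH => _ _ _ ->.
Qed.

Lemma H_neq0 x : 0 < H x -> x != 0.
Proof. by apply: contraTneq => ->; case: hH => _ _ _ ->; rewrite ltxx. Qed.

Lemma H_homog (t : R) x : 0 < t -> H (t *: x) = t * H x.
Proof.
have [->|x0 t0] := eqVneq x 0; last by case: hH => _ + _ _; apply.
by rewrite scaler0; case: hH => _ _ _ ->; rewrite mulr0.
Qed.

Lemma H_normalized x : x != 0 -> H ((H x)^-1 *: x) = 1.
Proof.
by move=> /H_gt0 Hx; rewrite H_homog ?invr_gt0 // mulVf // gt_eqF.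
Qed.

Lemma H_is_derive x i : x != 0 -> is_derive x (delta_mx 0 i) H (partial i H x).
Proof.
by move=> x0; case: hH => -[ck _] _ _ _; apply: (Ck_is_derive (s := [::]) _ ck).
Qed.

Lemma partialH_is_derive x i j : x != 0 ->
  is_derive x (delta_mx 0 i) (partial j H) (partial i (partial j H) x).
Proof.
by move=> x0; case: hH => -[ck _] _ _ _; apply: (Ck_is_derive (s := [:: j]) _ ck).
Qed.

Lemma H_partials_continuous (s : seq 'I_n) x : x != 0 -> (size s <= 3)%N ->
  {for x, continuous (partials s H)}.
Proof. by move=> x0 s3; case: hH => -[[_ cont] _] _ _ _; apply: cont. Qed.

Lemma H_is_deriveE x z : x != 0 -> is_derive x z H (dotv (grad H x) z).
Proof.
move=> x0; have : is_derive x z H (\sum_i z 0 i * partial i H x).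
  apply: (is_derive_partials (g := fun i => partial i H)) => i.
    by have := near_neq0 x0; apply: filterS => y; exact: H_is_derive.
  exact: (H_partials_continuous (s := [:: i])).
move=> d; apply: (is_derive_eq d).
by apply: eq_bigr => i _; rewrite mxE mulrC.
Qed.

Lemma partialH_is_deriveE x z j : x != 0 ->
  is_derive x z (partial j H) (\sum_i z 0 i * hess H x i j).
Proof.
move=> x0; under eq_bigr do rewrite mxE.
apply: (is_derive_partials (g := fun i => partial i (partial j H))) => i.
  by have := near_neq0 x0; apply: filterS => y; exact: partialH_is_derive.
exact: (H_partials_continuous (s := [:: i; j])).
Qed.

Lemma euler_H x : x != 0 -> dotv (grad H x) x = H x.
Proof.
move=> x0; rewrite -[RHS]mul1r; apply: (is_derive_euler (k := 1) _ x0).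
  by move=> t y t0 y0; rewrite H_homog.
exact: H_is_deriveE.
Qed.

Lemma partial_homog (f : 'rV[R]_n -> R) (i : 'I_n) (t c : R) x :
  0 < t -> x != 0 -> (forall y, y != 0 -> f (t *: y) = c * f y) ->
  is_derive x (delta_mx 0 i) f (partial i f x) ->
  partial i f (t *: x) = t^-1 * (c * partial i f x).
Proof.
move=> t0 x0 fc fd.
suff : is_derive (t *: x) (delta_mx 0 i) f (t^-1 * (c * partial i f x)).
  by case.
apply: is_derive_scale; first by rewrite gt_eqF.
have cfd : is_derive x (delta_mx 0 i) (c \*: f) (c *: partial i f x).
  exact: is_deriveZ.
apply: near_eq_is_derive cfd.
by have := near_neq0 x0; apply: filterS => y /fc ->.
Qed.

Lemma partialH_homog t x i : 0 < t -> x != 0 ->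
  partial i H (t *: x) = partial i H x.
Proof.
move=> t0 x0; have dH := H_is_derive i x0.
rewrite (@partial_homog H i t t) ?mulKf ?gt_eqF // => y _.
by rewrite H_homog.
Qed.

Lemma gradH_homog t x : 0 < t -> x != 0 -> grad H (t *: x) = grad H x.
Proof. by move=> t0 x0; apply/rowP => i; rewrite !mxE partialH_homog. Qed.

Lemma hessH_homog t x : 0 < t -> x != 0 ->
  hess H (t *: x) = t^-1 *: hess H x.
Proof.
move=> t0 x0; apply/matrixP => i j; rewrite !mxE.
have dH := partialH_is_derive i j x0.
rewrite (@partial_homog (partial j H) i t 1) ?mul1r // => y y0.
by rewrite mul1r partialH_homog.
Qed.

(** The partial derivatives of H are homogeneous of degree 0, and Euler's
    identity is applied to each of them. *)
Lemma euler_hessH_l x : x != 0 -> x *m hess H x = 0.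
Proof.
move=> x0; apply/rowP => j; rewrite mxE [RHS]mxE -[RHS](mul0r (partial j H x)).
apply: (is_derive_euler (f := partial j H) (k := 0) _ x0).
  by move=> t y t0 y0; rewrite mul1r partialH_homog.
exact: partialH_is_deriveE.
Qed.

(** Here Euler's identity for H itself is differentiated in the direction [i].
    In terms of iterated derivatives, [x] is now paired with the inner
    differentiation, in [euler_hessH_l] with the outer one. *)
Lemma euler_hessH_r x : x != 0 -> hess H x *m x^T = 0.
Proof.
move=> x0; apply/colP => i; rewrite [RHS]mxE.
have d1 : is_derive x (delta_mx 0 i) (\sum_j (fun y : 'rV[R]_n => y 0 j * partial j H y))
    (\sum_j (x 0 j * partial i (partial j H) x + partial j H x * (i == j)%:R)).
  apply: is_derive_sum => j; have dH := partialH_is_derive i j x0.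
  have dj := is_derive_coord x (delta_mx 0 i) j.
  apply: is_derive_eq (is_deriveM dj dH) _.
  by rewrite mxE eqxx eq_sym.
have d2 : is_derive x (delta_mx 0 i) (\sum_j (fun y : 'rV[R]_n => y 0 j * partial j H y))
    (partial i H x).
  apply: near_eq_is_derive (H_is_derive i x0).
  have := near_neq0 x0; apply: filterS => y y0; rewrite -{1}euler_H // fct_sumE.
  by apply: eq_bigr => j _; rewrite mxE mulrC.
have : partial i H x = 
    (\sum_j (x 0 j * partial i (partial j H) x + partial j H x * (i == j)%:R)).
  by case: d1 => _ <-; case: d2 => _ <-.
have -> : \sum_j (x 0 j * partial i (partial j H) x +
    partial j H x * (i == j)%:R) = (hess H x *m x^T) i 0 + partial i H x.
  rewrite big_split /= mxE; congr (_ + _).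
    by apply: eq_bigr => j _; rewrite !mxE mulrC.
  rewrite (bigD1 i) //= eqxx mulr1 big1 ?addr0 // => j ji.
  by rewrite eq_sym (negbTE ji) mulr0.
move=> e; rewrite -[RHS](subrr (partial i H x)) {1}e addrK mxE.
by apply: eq_bigr => j _; rewrite !mxE.
Qed.

Lemma qform_hessH x z (a : R) : x != 0 ->
  qform (hess H x) (a *: x + z) = qform (hess H x) z.
Proof.
by move=> x0; apply: qform_degenerate; [exact: euler_hessH_l|exact: euler_hessH_r].
Qed.

End Homogeneous.

(** * The Hessian of the composition *)

Section Composition.
Variables (R : realType) (n : nat) (beta : R) (H : 'rV[R]_n -> R) (B : R -> R).
Hypothesis hH : H_standing beta H.
Hypothesis hB : B_standing beta B.
Implicit Types x z : 'rV[R]_n.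

Local Notation B1 := (B^`())%classic.
Local Notation B2 := (B^`(2))%classic.

Lemma B_is_derive (j : nat) (t : R) : (j < 3)%N -> 0 < t ->
  is_derive t 1 B^`(j) (B^`(j.+1) t).
Proof.
move=> j3 t0; case: hB => -[ck _] _ _ _ _.
exact: Ck_in_is_derive ck j3 (nbhs_pos t0).
Qed.

Lemma hess_comp x i j : x != 0 -> hess (B \o H) x i j =
  B2 (H x) * (partial i H x * partial j H x) + B1 (H x) * hess H x i j.
Proof.
move=> x0; rewrite [LHS]mxE [in RHS]mxE.
have Hx := H_gt0 hH x0.
have d1 y : y != 0 ->
    is_derive y (delta_mx 0 j) (B \o H) (B1 (H y) * partial j H y).
  move=> y0; apply: is_derive_compR; first exact: (H_is_derive hH).
  exact: (@B_is_derive 0 (H y) isT (H_gt0 hH y0)).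
have d2 : is_derive x (delta_mx 0 i) (B1 \o H) (B2 (H x) * partial i H x).
  apply: is_derive_compR; first exact: (H_is_derive hH).
  exact: (@B_is_derive 1 (H x) isT Hx).
have d3 := is_deriveM d2 (partialH_is_derive hH i j x0).
have -> : partial i (partial j (B \o H)) x =
    'D_(delta_mx 0 i) ((B1 \o H) * partial j H) x.
  apply: near_eq_derive.
  by have := near_neq0 x0; apply: filterS => y /d1 [].
case: d3 => _ ->; move: (partial _ _ x) (partial _ _ x) (partial _ _ x) => a b c.
rewrite /GRing.scale /=; ring.
Qed.

Lemma qform_hess_comp x z : x != 0 -> qform (hess (B \o H) x) z =
  B2 (H x) * dotv (grad H x) z ^+ 2 + B1 (H x) * qform (hess H x) z.
Proof.
move=> x0; have -> : dotv (grad H x) z = \sum_i partial i H x * z 0 i.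
  by apply: eq_bigr => i _; rewrite mxE.
have := fun i j => hess_comp i j x0; move: (B2 (H x)) (B1 (H x)) => b2 b1 hc.
rewrite /qform expr2 mulr_suml !mulr_sumr -big_split /=.
apply: eq_bigr => i _; rewrite !mulr_sumr -big_split /=.
apply: eq_bigr => j _; rewrite [X in X * _ * _ = _]hc.
move: (hess H x i j) (partial i H x) (partial j H x) (z 0 i) (z 0 j).
by move=> c d e f g; ring.
Qed.

Lemma qform_hess_radial x : x != 0 ->
  qform (hess (B \o H) x) x = B2 (H x) * H x ^+ 2.
Proof.
move=> x0; rewrite qform_hess_comp // (euler_H hH) //.
rewrite -[X in qform _ X]scale1r -[X in qform _ X]addr0 (qform_hessH hH) //.
by rewrite /qform big1 ?mulr0 ?addr0 // => i _; rewrite big1 // => j _; rewrite !mxE !mulr0.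
Qed.

(** H and its inverse are bounded on the unit sphere. *)
Lemma H_bounds : exists2 C : R, 0 < C &
  forall x, H x <= C * `|x| /\ `|x| <= C * H x.
Proof.
have [|C C0 CP] := @bounded_on_sphere R n bool
    (fun b x => if b then H x else (H x)^-1).
  move=> b x x0; have cH : {for x, continuous H}.
    exact: (H_partials_continuous hH (s := [::])).
  case: b => //; apply: continuousV => //.
  by rewrite gt_eqF // (H_gt0 hH).
exists C => // x; have [->|x0] := eqVneq x 0.
  by case: hH => _ _ _ ->; rewrite normr0 mulr0.
have [y y1 xy] := norm_scale_unit x0.
have nx : 0 < `|x| by rewrite normr_gt0.
have y0 : y != 0 by rewrite -normr_gt0 y1.
have Hy := H_gt0 hH y0.
rewrite {1 4}xy (H_homog hH) //; split.
  by rewrite mulrC ler_wpM2r //; have := CP true y y1; rewrite gtr0_norm.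
rewrite mulrCA ler_pMr // -ler_pdivrMr // mul1r.
by have := CP false y y1; rewrite gtr0_norm ?invr_gt0.
Qed.

Lemma gradH_bounded : exists2 C : R, 0 < C &
  forall x i, x != 0 -> `|partial i H x| <= C.
Proof.
have [|C C0 CP] := @bounded_on_sphere R n 'I_n (fun i => partial i H).
  by move=> i x x0; exact: (H_partials_continuous hH (s := [:: i])).
exists C => // x i x0; have [y y1 xy] := norm_scale_unit x0.
have y0 : y != 0 by rewrite -normr_gt0 y1.
by rewrite xy (partialH_homog hH) // ?normr_gt0 // CP.
Qed.

Lemma hessH_bounded : exists2 C : R, 0 < C &
  forall x i j, x != 0 -> `|hess H x i j| <= C / `|x|.
Proof.
have [|C C0 CP] := @bounded_on_sphere R n ('I_n * 'I_n)%type
    (fun ij => partial ij.1 (partial ij.2 H)).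
  by move=> -[i j] x x0; exact: (H_partials_continuous hH (s := [:: i; j])).
exists C => // x i j x0; have [y y1 xy] := norm_scale_unit x0.
have y0 : y != 0 by rewrite -normr_gt0 y1.
rewrite {1}xy (hessH_homog hH) // ?normr_gt0 // mxE normrM normfV normr_id.
by rewrite mulrC ler_wpM2r ?invr_ge0 // mxE; exact: (CP (i, j)).
Qed.

(** * Growth and ellipticity conditions: (A) and (A)' *)

(** The same comparison for the Euclidean norm, with a constant at least 1 as
    required by [powR_comparable]. *)
Lemma H_enorm_bounds : exists2 M : R, 1 <= M &
  forall x, H x <= M * enorm x /\ enorm x <= M * H x.
Proof.
have [C C0 CP] := H_bounds.
have n1 : 1 <= n.+1%:R :> R by rewrite ler1n.
exists (1 + n.+1%:R * C) => [|x]; first by rewrite lerDl mulr_ge0 // ltW.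
have [Hx xH] := CP x; have H0 := H_ge0 hH x; have e0 := enorm_ge0 x.
have xe := ler_norm_enorm x; have ex := ler_enorm_norm x.
split.
  apply: (le_trans Hx); apply: (@le_trans _ _ (C * enorm x)).
    by rewrite ler_wpM2l // ltW.
  rewrite ler_wpM2r // -[leLHS]mul1r.
  by rewrite -[leLHS]add0r lerD // ler_wpM2r // ltW.
apply: (le_trans ex); rewrite mulrDl mul1r -mulrA.
by rewrite -[leLHS]add0r lerD // ler_wpM2l.
Qed.

(** Split [z = a *: x + e] with [e] tangent to the level set of H. The lower
    bounds in (A)' and the ellipticity of H control [(a * H x) ^+ 2] and [enorm
    e ^+ 2], whose sum dominates [enorm z ^+ 2]; the upper bound is estimated
    entry by entry. *)
Lemma assumption_A'_A : assumption_A' B H -> assumption_A B H.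
Proof.
move=> [p [k [g [G [l [p1 kI [g0 G0 l0] ell BP]]]]]].
have [k0 _] := andP kI.
have [M M1 MP] := H_enorm_bounds.
have M0 : 0 < M by rewrite (lt_le_trans ltr01).
have [Cg Cg0 CgP] := gradH_bounded.
have [Ch Ch0 ChP] := hessH_bounded.
pose K := M `^ `|p - 2|; have K0 : 0 < K by rewrite powR_gt0.
(* [L] compares [enorm z ^+ 2] with its two components, see [zL] below. *)
pose L := 2 * (M ^+ 2 + l^-1).
have L0 : 0 < L by rewrite mulr_gt0 // addr_gt0 ?exprn_gt0 ?invr_gt0.
pose N := n%:R ^+ 2 * (Cg ^+ 2 + Ch * (n.+1%:R * M)) + 1 : R.
have N0 : 0 < N.
  by rewrite ltr_wpDl // mulr_ge0 ?sqr_ge0 // addr_ge0 ?sqr_ge0 // !mulr_ge0 // ltW.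
exists p, k, (g / (L * K)), (G * (N * K)).
have gLK : 0 < g / (L * K) by rewrite divr_gt0 // mulr_gt0.
have GNK : 0 < G * (N * K) by rewrite !mulr_gt0.
split=> // x z x0.
have Hx := H_gt0 hH x0; have ex := enorm_gt0 x0.
have [Hxe xeH] := MP x.
have := BP _ Hx; set W := (k + H x) `^ _; set w := (k + enorm x) `^ _.
have W0 : 0 < W by rewrite powR_gt0 // ltr_wpDl.
have w0 : 0 < w by rewrite powR_gt0 // ltr_wpDl.
have Ww : W <= K * w by exact: powR_shift_comparable.
have wW : w <= K * W by exact: powR_shift_comparable.
move=> [/andP[B1l B1u] /andP[B2l B2u]]; split.
  pose a := dotv (grad H x) z / H x; pose e := z - a *: x.
  have ge : dotv (grad H x) e = 0.
    rewrite /e -scaleNr dotvDr dotvZr (euler_H hH) // mulNr divfK ?subrr //.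
    by rewrite gt_eqF.
  have ze : z = a *: x + e by rewrite addrC subrK.
  have gz : dotv (grad H x) z = a * H x by rewrite divfK // gt_eqF.
  have elle : l * enorm e ^+ 2 <= H x * qform (hess H x) z.
    have := ell _ e (H_normalized hH x0).
    rewrite (gradH_homog hH) ?invr_gt0 // (hessH_homog hH) ?invr_gt0 // invrK.
    move=> /(_ ge); rewrite [X in _ <= _ * qform _ X]ze (qform_hessH hH) //.
    suff -> : qform (H x *: hess H x) e = H x * qform (hess H x) e by [].
    by rewrite !qformE -scalemxAr -scalemxAl mxE.
  clearbody e; clearbody a.
  rewrite qform_hess_comp // gz.
  have q0 : 0 <= qform (hess H x) z.
    by rewrite -(pmulr_rge0 _ Hx) (le_trans _ elle) // mulr_ge0 ?sqr_ge0 // ltW.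
  have low : g * W * ((a * H x) ^+ 2 + l * enorm e ^+ 2) <=
      B2 (H x) * (a * H x) ^+ 2 + B1 (H x) * qform (hess H x) z.
    rewrite mulrDr lerD //; first by rewrite ler_wpM2r ?sqr_ge0.
    apply: (@le_trans _ _ (g * W * (H x * qform (hess H x) z))).
      by rewrite ler_wpM2l // mulr_ge0 // ltW.
    by rewrite mulrA ler_wpM2r.
  apply: le_trans low.
  have zL : enorm z ^+ 2 <= L * ((a * H x) ^+ 2 + l * enorm e ^+ 2).
    rewrite [in leLHS]ze; apply: (le_trans (sqr_enormD _ _)).
    rewrite /L -mulrA ler_pM2l // enormZ exprMn real_normK ?num_real //.
    have x2 : enorm x ^+ 2 <= M ^+ 2 * H x ^+ 2.
      rewrite -exprMn ler_pXn2r ?nnegrE ?mulr_ge0 //; exact: ltW.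
    rewrite mulrDl !mulrDr mulKf ?gt_eqF // !exprMn.
    have := ler_wpM2l (sqr_ge0 a) x2.
    have : 0 <= M ^+ 2 * (l * enorm e ^+ 2).
      by rewrite mulr_ge0 ?sqr_ge0 // mulr_ge0 ?sqr_ge0 // ltW.
    have : 0 <= l^-1 * (a ^+ 2 * H x ^+ 2).
      by rewrite mulr_ge0 ?invr_ge0 ?(ltW l0) // mulr_ge0 ?sqr_ge0.
    lra.
  apply: (@le_trans _ _ (g / (L * K) * (K * W) *
      (L * ((a * H x) ^+ 2 + l * enorm e ^+ 2)))).
    apply: ler_pM => //; last by rewrite ler_pM2l.
      by rewrite mulr_ge0 // ltW.
    exact: sqr_ge0.
  rewrite le_eqVlt; apply/orP; left; apply/eqP; field.
  by rewrite !gt_eqF.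
have ent i j : `|hess (B \o H) x i j| <= G * W * (Cg ^+ 2 + Ch * (n.+1%:R * M)).
  rewrite hess_comp //; have := CgP x i x0; have := CgP x j x0.
  have := ChP x i j x0; move: (hess H x i j) (partial i H x) (partial j H x).
  move=> h d e hP eP dP; rewrite mulrDr; apply: (le_trans (ler_normD _ _)).
  have GW : 0 <= G * W by rewrite mulr_ge0 // ltW.
  apply: lerD; rewrite normrM.
    apply: ler_pM => //.
      by rewrite ger0_norm // (le_trans _ B2l) // mulr_ge0 // ltW.
    by rewrite normrM expr2; apply: ler_pM.
  have Hn : H x / `|x| <= n.+1%:R * M.
    rewrite ler_pdivrMr ?normr_gt0 // (le_trans Hxe) // -mulrA mulrCA.
    by rewrite ler_pM2l // ler_enorm_norm.
  apply: (@le_trans _ _ (G * W * H x * (Ch / `|x|))).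
    apply: ler_pM => //.
    by rewrite ger0_norm // (le_trans _ B1l) // mulr_ge0 // ?mulr_ge0 // ltW.
  have -> : G * W * H x * (Ch / `|x|) = G * W * (Ch * (H x / `|x|)) by ring.
  by rewrite !ler_pM2l // mulr_gt0.
apply: (@le_trans _ _ (\sum_(i < n) \sum_(j < n)
    G * W * (Cg ^+ 2 + Ch * (n.+1%:R * M)))).
  by apply: ler_sum => i _; apply: ler_sum => j _; exact: ent.
rewrite !sumr_const !card_ord -!mulrnA -[leLHS]mulr_natl natrM -expr2 /N.
have : 0 <= Cg ^+ 2 + Ch * (n.+1%:R * M).
  by rewrite addr_ge0 ?sqr_ge0 // mulr_ge0 ?(ltW Ch0) // mulr_ge0 // ltW.
move: (Cg ^+ 2 + _) (n%:R ^+ 2) (@sqr_ge0 R n%:R) => c d d0 c0.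
have -> : d * (G * W * c) = G * (d * c * W) by ring.
rewrite -[leRHS]mulrA ler_pM2l // -[leRHS]mulrA; apply: ler_pM => //.
- exact: mulr_ge0.
- exact: ltW.
- by rewrite lerDl.
Qed.

(** The ray is spanned by the normalized first basis vector [x]; the tangential
    direction [e] is the second basis vector corrected by a multiple of [x],
    and it is nonzero because its second coordinate is 1. *)
Lemma assumption_A_A' : (2 <= n)%N -> assumption_A B H -> assumption_A' B H.
Proof.
move=> n2 [p [k [g [G [p1 kI g0 G0 AP]]]]].
have [k0 _] := andP kI.
have [M M1 MP] := H_enorm_bounds.
have M0 : 0 < M by rewrite (lt_le_trans ltr01).
pose i0 : 'I_n := Ordinal (ltnW n2); pose i1 : 'I_n := Ordinal n2.
pose v : 'rV[R]_n := delta_mx 0 i0.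
have v0 : v != 0 by exact: delta_neq0.
pose x : 'rV[R]_n := (H v)^-1 *: v.
have Hx : H x = 1 by rewrite (H_normalized hH).
have x0 : x != 0 by apply: (H_neq0 hH); rewrite Hx.
pose e : 'rV[R]_n := delta_mx 0 i1 - partial i1 H x *: x.
have e0 : e != 0.
  apply/eqP => /rowP/(_ i1); rewrite !mxE !eqxx mulr0 mulr0 subr0 => /eqP.
  by rewrite oner_eq0.
have ge : dotv (grad H x) e = 0.
  rewrite /e -scaleNr dotvDr dotvZr (euler_H hH) // Hx mulr1.
  rewrite /dotv (bigD1 i1) //= big1 ?addr0 => [|i ii]; last first.
    by rewrite [delta_mx _ _ _ _]mxE (negbTE ii) andbF mulr0.
  by rewrite !mxE !eqxx mulr1 subrr.
have tx0 t : 0 < t -> t *: x != 0.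
  by move=> t0; rewrite scaler_eq0 gt_eqF.
have Htx t : 0 < t -> H (t *: x) = t by move=> t0; rewrite (H_homog hH) // Hx mulr1.
pose m := enorm x; have m0 : 0 < m by rewrite enorm_gt0.
pose a := enorm e; have a0 : 0 < a by rewrite enorm_gt0.
have [Hm mH] := MP x; rewrite Hx mulr1 -/m in Hm mH.
pose q := qform (hess H x) e.
pose K := M `^ `|p - 2|; have K0 : 0 < K by rewrite powR_gt0.
have wP t : 0 < t ->
    (k + t) `^ (p - 2) <= K * (k + enorm (t *: x)) `^ (p - 2) /\
    (k + enorm (t *: x)) `^ (p - 2) <= K * (k + t) `^ (p - 2).
  move=> t0; rewrite enormZ gtr0_norm // -/m.
  have h1 : t * m <= M * t by rewrite mulrC ler_pM2r.
  have h2 : t <= M * (t * m) by rewrite mulrCA ler_peMr // ltW.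
  by split; apply: powR_shift_comparable => //; rewrite mulr_gt0.
have hessP t z : 0 < t ->
    g * enorm z ^+ 2 / K * (k + t) `^ (p - 2) <= qform (hess (B \o H) (t *: x)) z
    <= G * enorm z ^+ 2 * K * (k + t) `^ (p - 2).
  move=> t0; have [lo up] := AP (t *: x) z (tx0 t t0).
  have [wl wu] := wP t t0; apply/andP; split.
    apply: le_trans lo; set w := (k + t) `^ _.
    have -> : g * enorm z ^+ 2 / K * w = g * (K^-1 * w) * enorm z ^+ 2 by ring.
    by apply: ler_wpM2r; rewrite ?sqr_ge0 // ler_pM2l // ler_pdivrMl.
  apply: (le_trans (qform_ler _ _)).
  set w := (k + t) `^ _.
  have -> : G * enorm z ^+ 2 * K * w = G * (K * w) * enorm z ^+ 2 by ring.
  apply: ler_wpM2r; first exact: sqr_ge0.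
  by apply: (le_trans up); rewrite ler_pM2l.
have B2P t : 0 < t -> g * m ^+ 2 / K * (k + t) `^ (p - 2) <= B2 t
    <= G * m ^+ 2 * K * (k + t) `^ (p - 2).
  move=> t0; have := hessP t x t0.
  suff -> : qform (hess (B \o H) (t *: x)) x = B2 t by [].
  rewrite -[X in qform _ X](scalerK (negbT (gt_eqF t0))) qformZ.
  rewrite qform_hess_radial ?tx0 // Htx //.
  by rewrite mulrC exprVn mulfK // expf_neq0 // gt_eqF.
have B1P t : 0 < t -> g * a ^+ 2 / K * (k + t) `^ (p - 2) <= B1 t / t * q
    <= G * a ^+ 2 * K * (k + t) `^ (p - 2).
  move=> t0; have := hessP t e t0.
  suff -> : qform (hess (B \o H) (t *: x)) e = B1 t / t * q by [].
  rewrite qform_hess_comp ?tx0 // (gradH_homog hH) // ge.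
  rewrite expr0n mulr0 add0r (Htx t t0).
  rewrite (hessH_homog hH t0 x0).
  by rewrite qformE -scalemxAr -scalemxAl mxE -qformE mulrA.
have B1_gt0 t : 0 < t -> 0 < B1 t by case: hB => _ _ _ _ + t0 => /(_ t t0) [].
have q0 : 0 < q.
  have /andP[B1l _] := B1P 1 ltr01.
  rewrite -(pmulr_rgt0 _ (B1_gt0 1 ltr01)) -[X in X * q]divr1.
  apply: lt_le_trans B1l; rewrite mulr_gt0 //; last by rewrite powR_gt0 // ltr_wpDl.
  by rewrite divr_gt0 // mulr_gt0 // exprn_gt0.
pose lo1 := g * a ^+ 2 / K / q; pose lo2 := g * m ^+ 2 / K.
pose up1 := G * a ^+ 2 * K / q; pose up2 := G * m ^+ 2 * K.
have lo10 : 0 < lo1.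
  by rewrite divr_gt0 // divr_gt0 // mulr_gt0 // exprn_gt0.
have lo20 : 0 < lo2 by rewrite divr_gt0 // mulr_gt0 // exprn_gt0.
have up10 : 0 < up1.
  by rewrite divr_gt0 // mulr_gt0 // mulr_gt0 // exprn_gt0.
pose l := g * (k + 1) `^ (p - 2) / K / B1 1.
have w10 : 0 < (k + 1) `^ (p - 2) by rewrite powR_gt0 // ltr_wpDl.
exists p, k, (Num.min lo1 lo2), (Num.max up1 up2), l; split => //.
- split; first by rewrite lt_min lo10.
    by rewrite lt_max up10.
  by rewrite divr_gt0 ?B1_gt0 // divr_gt0 // mulr_gt0.
- move=> y z Hy gz.
  have y0 : y != 0 by apply: (H_neq0 hH); rewrite Hy.
  have e1 := qform_hess_comp z y0.
  rewrite gz expr0n mulr0 add0r Hy in e1.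
  have [lo _] := AP y z y0; rewrite e1 in lo.
  rewrite /l mulrAC ler_pdivrMr ?B1_gt0 // [leRHS]mulrC; apply: le_trans lo.
  apply: ler_wpM2r; first exact: sqr_ge0.
  rewrite -mulrA ler_pM2l // ler_pdivrMr // mulrC.
  have [h1 h2] := MP y; rewrite Hy mulr1 in h1 h2.
  by apply: powR_shift_comparable => //; rewrite ?enorm_gt0 // mulr1.
move=> t t0; have w0 : 0 <= (k + t) `^ (p - 2) by rewrite powR_ge0.
have /andP[b1l b1u] := B1P t t0; have /andP[b2l b2u] := B2P t t0.
have b1l' : lo1 * (k + t) `^ (p - 2) * t <= B1 t.
  rewrite -ler_pdivlMr // -(ler_pM2r q0); apply: le_trans b1l.
  by rewrite /lo1 mulrAC divfK // gt_eqF.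
have b1u' : B1 t <= up1 * (k + t) `^ (p - 2) * t.
  rewrite -ler_pdivrMr // -(ler_pM2r q0); apply: (le_trans b1u).
  by rewrite /up1 [leRHS]mulrAC divfK // gt_eqF.
split; apply/andP; split.
- apply: le_trans b1l'; rewrite ler_pM2r // ler_wpM2r //.
  by rewrite ge_min lexx.
- apply: (le_trans b1u'); rewrite ler_pM2r // ler_wpM2r //.
  by rewrite le_max lexx.
- by apply: le_trans b2l; rewrite ler_wpM2r // ge_min lexx orbT.
- by apply: (le_trans b2u); rewrite ler_wpM2r // le_max lexx orbT.
Qed.

(** * Regularity at the origin forces a quadratic form: (B) implies (B)' *)

(** With [c = 1 / H e] the function [g 0] below is F restricted to the line
    directed by the basis vector [e], parametrized so that H grows at unit
    speed: it extends B, and [g k] is its k-th derivative. A basis direction is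
    chosen because the [g k] are then values of iterated partial derivatives.
    *)
Lemma assumption_B_B' : (2 <= n)%N -> assumption_B beta B H ->
  assumption_B' beta B H.
Proof.
move=> n2 [[ck hold] pos].
pose i0 : 'I_n := Ordinal (ltnW n2); pose e : 'rV[R]_n := delta_mx 0 i0.
have e0 : e != 0 by exact: delta_neq0.
pose c := (H e)^-1; have c0 : 0 < c by rewrite invr_gt0 (H_gt0 hH).
pose D k := partials (nseq k i0) (B \o H).
pose g k (s : R) := c ^+ k * D k ((s * c) *: e).
have gd k (s : R) : (k < 3)%N -> is_derive s 1 (g k) (g k.+1 s).
  move=> k3.
  have d1 : is_derive ((s * c) *: e + 0) e (D k) (D k.+1 ((s * c) *: e)).
    by rewrite addr0; apply: (Ck_is_derive _ ck) => //; rewrite size_nseq.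
  have d2 := (is_derive_line _ _ _ _ _).1 d1.
  have d3 : is_derive s 1 ( *%R^~ c) c.
    rewrite (_ : *%R^~ c = c \*: id); first by apply: is_derive_eq; rewrite [_ *: 1]mulr1.
    by apply/funext => u; rewrite mulrC.
  have d4 := is_derive_compR d3 d2.
  have d5 : is_derive s 1 (c ^+ k \*: (fun s : R => D k ((s * c) *: e + 0)))
      (c ^+ k *: (D k.+1 ((s * c) *: e) * c)) by exact: is_deriveZ d4.
  rewrite (_ : g k = c ^+ k \*: (fun s : R => D k ((s * c) *: e + 0))).
    by apply: (is_derive_eq d5); rewrite /g exprSr /GRing.scale /=; ring.
  by apply/funext => u; rewrite /g /= addr0.
have Dc k : (k <= 3)%N -> continuous (D k).
  by move=> k3 x; case: ck => _; apply => //; rewrite size_nseq.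
have linec : continuous (fun s : R => (s * c) *: e).
  move=> s; apply: cvgZr_tmp; apply: cvgM; [exact: cvg_id | exact: cvg_cst].
have gc k : (k <= 3)%N -> continuous (g k).
  move=> k3 s; apply: cvgM; first exact: cvg_cst.
  by apply: (continuous_comp (linec s)); exact: Dc.
have Bg s : 0 <= s -> B s = g 0%N s.
  rewrite /g expr0 mul1r /D /= le_eqVlt => /predU1P[<-|s0].
    by rewrite mul0r scale0r; case: hH => _ _ _ ->.
  by rewrite (H_homog hH) ?mulr_gt0 // -mulrA mulVf ?mulr1 // gt_eqF // (H_gt0 hH).
have Bgk := derive1n_in_eq Bg gd.
pose b := g 2%N 0.
have B2g s : 0 < s -> B2 s = g 2%N s.
  move=> s0; have := Bgk 2%N s isT (ltW s0).
  by rewrite (derive1n_in_nbhs B 2 (nbhs_nneg s0)).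
(* The radial identity at [t *: x], in the limit of [t] decreasing to 0. *)
have hess0 x : qform (hess (B \o H) 0) x = b * H x ^+ 2.
  have [->|x0] := eqVneq x 0.
    case: hH => _ _ _ ->; rewrite expr0n mulr0 /qform big1 // => i _.
    by rewrite big1 // => j _; rewrite [(0 : 'rV[R]_n) 0 j]mxE mulr0.
  pose f (t : R) := qform (hess (B \o H) (t *: x)) x - g 2%N (t * H x) * H x ^+ 2.
  suff : f 0 = 0 by rewrite /f scale0r mul0r => /eqP; rewrite subr_eq0 => /eqP.
  apply: continuous_at0_eq0.
    have tx : (fun t : R => t *: x) @ (0 : R) --> (0 : R) *: x.
      by apply: cvgZr_tmp; exact: cvg_id.
    apply: cvgB.
      apply: cvg_big => [|i _]; first exact: add_continuous.
      apply: cvg_big => [|j _]; first exact: add_continuous.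
      apply: cvgM; last exact: cvg_cst.
      apply: cvgM; last exact: cvg_cst.
      rewrite (_ : (fun t : R => hess (B \o H) (t *: x) i j) =
        partials [:: i; j] (B \o H) \o (fun t : R => t *: x)).
        rewrite [hess _ _ _ _]mxE.
        apply: (continuous_comp tx).
        by case: ck => _; apply.
      by apply/funext => t; rewrite mxE.
    apply: cvgM; last exact: cvg_cst.
    apply: (@continuous_comp _ _ _ (fun t : R => t * H x) (g 2%N)).
      by apply: cvgM; [exact: cvg_id | exact: cvg_cst].
    exact: gc.
  move=> t t0; have Hx := H_gt0 hH x0; have t1 := lt0r_neq0 t0.
  rewrite /f -[X in qform _ X](scalerK t1) qformZ.
  rewrite qform_hess_radial ?scaler_eq0 ?gt_eqF // (H_homog hH _ t0).
  rewrite B2g ?mulr_gt0 //; apply/eqP; rewrite subr_eq0; apply/eqP.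
  by field; rewrite gt_eqF.
have b0 : 0 < b.
  have [ga [ga0 gaP]] := pos 1 ltr01.
  rewrite -(pmulr_lgt0 _ (exprn_gt0 2 (H_gt0 hH e0))) -hess0.
  apply: lt_le_trans (gaP 0 e _); first by rewrite mulr_gt0 // exprn_gt0 // enorm_gt0.
  by rewrite /enorm /dotv big1 ?sqrtr0 // => i _; rewrite mxE mul0r.
pose A := hess (B \o H) 0.
(* The Hessian at 0 is symmetrized by hand; its quadratic form is unchanged. *)
pose M := (2 * b)^-1 *: (A + A^T).
have qM x : qform M x = H x ^+ 2.
  have qAT : qform A^T x = qform A x.
    rewrite /qform exchange_big; apply: eq_bigr => i _; apply: eq_bigr => j _.
    by rewrite mxE mulrAC.
  have -> : qform M x = (2 * b)^-1 * (qform A x + qform A^T x).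
    by rewrite !qformE -scalemxAr -scalemxAl mulmxDr mulmxDl mxE [in LHS]mxE.
  by rewrite qAT hess0; field; rewrite gt_eqF.
have HM x : H x = Num.sqrt (qform M x).
  by rewrite qM sqrtr_sqr ger0_norm // (H_ge0 hH).
have HN x : H (- x) = H x.
  by rewrite !HM -[- x]scaleN1r qformZ sqrrN expr1n mul1r.
have g3 : g 3%N 0 = 0.
  (* H is even, hence so is [g 0], and derivatives alternate in parity. *)
  have gN k s : (k <= 3)%N -> g k (- s) = (-1) ^+ k * g k s.
    elim: k s => [|k IH] s k3.
      rewrite expr0 !mul1r /g /D /= mulNr scaleNr; by rewrite HN.
    have d1 := is_derive_compR (is_deriveNid s 1) (gd k (- s) k3).
    have d2 := is_deriveZ ((-1) ^+ k) (gd k s k3).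
    have e1 : g k \o -%R = (-1) ^+ k \*: g k.
      by apply/funext => u; rewrite /= IH // ltnW.
    rewrite e1 in d1; rewrite exprS mulN1r mulNr -[LHS]opprK; congr (- _).
    by case: d1 => _; case: d2 => _ -> /esym; rewrite mulrN1.
  have := gN 3%N 0 isT; rewrite oppr0; lra.
split.
- split; first exact: Ck_in_eq Bg gd (gc 3%N isT).
  move=> K Kc KD.
  have Kc' : compact ((fun s : R => (s * c) *: e) @` K).
    by apply: continuous_compact Kc; exact: continuous_subspaceT.
  have [C CP] := hold (nseq 3 i0) (size_nseq _ _) _ Kc' (fun _ _ => I).
  exists (c ^+ 3 * (C * `|c *: e| `^ beta)) => s t Ks Kt.
  have Ks0 : 0 <= s by have := KD _ Ks; rewrite /= in_itv /= andbT.
  have Kt0 : 0 <= t by have := KD _ Kt; rewrite /= in_itv /= andbT.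
  have -> : derive1n_in `[0, +oo[ 3 B s = g 3%N s by exact: Bgk.
  have -> : derive1n_in `[0, +oo[ 3 B t = g 3%N t by exact: Bgk.
  rewrite /g -mulrBr normrM gtr0_norm ?exprn_gt0 // -[leRHS]mulrA.
  rewrite ler_pM2l ?exprn_gt0 // -mulrA.
  have -> : `|c *: e| `^ beta * `|s - t| `^ beta =
      `|(s * c) *: e - (t * c) *: e| `^ beta.
    by rewrite mulrC -powRM // -normrZ scalerA mulrBl scalerBl.
  by apply: CP; [exists s | exists t].
- by rewrite Bgk.
- by rewrite Bgk.
- exists M; split; last exact: HM.
  split; last by move=> z z0; rewrite qM exprn_gt0 // (H_gt0 hH).
  by rewrite /M linearZ /= linearD /= trmxK addrC.
Qed.

End Composition.

(** * One-dimensional estimates for a profile with vanishing odd derivatives *)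

(** A profile [b0] with derivatives [b1], [b2], [b3] on the half-line whose odd
    derivatives vanish at 0, so that its even extension to the line is of class
    C^{3,beta}. The derivatives are explicit functions, with values at 0,
    because their behaviour at the endpoint matters. *)
Record even_profile (R : realType) (beta : R) (b0 b1 b2 b3 : R -> R) : Prop := {
  profile_exponent : 0 < beta < 1;
  profile_deriv0 : forall t : R, 0 < t -> is_derive t 1 b0 (b1 t);
  profile_deriv1 : forall t : R, 0 < t -> is_derive t 1 b1 (b2 t);
  profile_deriv2 : forall t : R, 0 < t -> is_derive t 1 b2 (b3 t);
  profile_cont0 : {within `[0, +oo[%classic, continuous b0};
  profile_cont1 : {within `[0, +oo[%classic, continuous b1};
  profile_cont2 : {within `[0, +oo[%classic, continuous b2};
  profile_b00 : b0 0 = 0;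
  profile_b10 : b1 0 = 0;
  profile_b30 : b3 0 = 0;
  profile_holder : forall T : R, exists2 C, 0 < C & forall s t,
    0 <= s <= T -> 0 <= t <= T -> `|b3 s - b3 t| <= C * `|s - t| `^ beta
}.

Section Profile.
Variables (R : realType) (beta : R) (b0 b1 b2 b3 : R -> R).
Local Notation D := `[0, +oo[%classic.
Hypothesis hb : even_profile beta b0 b1 b2 b3.
Let betaP := profile_exponent hb.
Let d0 := profile_deriv0 hb.
Let d1 := profile_deriv1 hb.
Let d2 := profile_deriv2 hb.
Let c0 := profile_cont0 hb.
Let c1 := profile_cont1 hb.
Let c2 := profile_cont2 hb.
Let b00 := profile_b00 hb.
Let b10 := profile_b10 hb.
Let b30 := profile_b30 hb.
Let b3_holder := profile_holder hb.

(** The quotient [b1 t / t], extended continuously to 0. *)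
Definition slope (t : R) := if t == 0 then b2 0 else b1 t / t.
(** This is the derivative of [slope] ([slope_is_derive]). Its value at 0 is
    the default 0, which is also its limit. *)
Definition defect (t : R) := (b2 t - slope t) / t.

Lemma slope0 : slope 0 = b2 0. Proof. by rewrite /slope eqxx. Qed.

Lemma slopeE t : 0 < t -> slope t = b1 t / t.
Proof. by move=> t0; rewrite /slope gt_eqF. Qed.

Lemma defectK t : 0 <= t -> t * defect t = b2 t - slope t.
Proof.
rewrite le_eqVlt => /predU1P[<-|t0]; first by rewrite slope0 subrr mul0r.
by rewrite mulrC divfK // gt_eqF.
Qed.

Lemma MVT_half_line (f df : R -> R) (t : R) :
  {within D, continuous f} -> (forall s : R, 0 < s -> is_derive s 1 f (df s)) ->
  0 < t -> exists2 s, 0 < s < t & f t - f 0 = df s * t.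
Proof.
move=> cf fd t0; have [||s] := @MVT R f df 0 t t0.
- by move=> s; rewrite in_itv /= => /andP[s0 _]; exact: fd.
- apply: continuous_subspaceW cf => s; rewrite /= !in_itv /= andbT.
  by case/andP.
- by rewrite in_itv /= subr0 => s0 e; exists s.
Qed.

Lemma powR_mono (s t : R) : 0 <= s -> s <= t -> s `^ beta <= t `^ beta.
Proof.
have [be0 _] := andP betaP.
move=> s0 st; apply: ge0_ler_powR; rewrite ?nnegrE //; first exact: ltW.
exact: le_trans st.
Qed.

(** Taylor expansion at 0: the bound on [b3] comes from the Hoelder condition
    and [b3 0 = 0], and the mean value theorem integrates it twice. *)
Lemma profile_bounds (T : R) : exists2 C, 0 < C & forall t, 0 < t <= T ->
  [/\ `|b3 t| <= C * t `^ beta,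
      `|b2 t - b2 0| <= C * t `^ beta * t &
      `|b1 t - b2 0 * t| <= C * t `^ beta * t * t].
Proof.
have [C C0 CP] := b3_holder T; exists C => // t /andP[t0 tT].
have e3 s : 0 < s <= T -> `|b3 s| <= C * s `^ beta.
  move=> /andP[s0 sT]; have := CP s 0; rewrite b30 !subr0 (gtr0_norm s0).
  by apply; rewrite ?lexx /= ?(ltW s0) // (ltW (lt_le_trans s0 sT)).
have e2 s : 0 < s <= T -> `|b2 s - b2 0| <= C * s `^ beta * s.
  move=> /andP[s0 sT]; have [a /andP[a0 as_] ->] := MVT_half_line c2 d2 s0.
  rewrite normrM (gtr0_norm s0) ler_wpM2r ?(ltW s0) //.
  apply: (le_trans (e3 _ _)); first by rewrite a0 (le_trans (ltW as_)).
  by rewrite ler_pM2l // powR_mono // ltW.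
split; [by apply: e3; rewrite t0|by apply: e2; rewrite t0|].
(* The bound on [b1] is the mean value theorem for [b1 t - b2 0 * t]. *)
have cg : {within D, continuous (b1 - b2 0 \*: id)}.
  move=> s; apply: cvgB; first exact: c1.
  by apply: continuous_subspaceT => u; apply: cvgZl_tmp; exact: cvg_id.
have dg (s : R) : 0 < s -> is_derive s 1 (b1 - b2 0 \*: id) (b2 s - b2 0).
  move=> s0; have h1 := d1 s0; apply: is_derive_eq.
  by rewrite [_ *: 1]mulr1.
have [a /andP[a0 at_]] := MVT_half_line cg dg t0.
rewrite -[(b1 - _) t]/(b1 t - b2 0 * t) -[(b1 - _) 0]/(b1 0 - b2 0 * 0).
rewrite b10 mulr0 !subr0 => ->.
rewrite normrM (gtr0_norm t0) ler_wpM2r ?(ltW t0) //.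
apply: (le_trans (e2 _ _)); first by rewrite a0 (le_trans (ltW at_)).
apply: ler_pM; rewrite ?(ltW a0) ?(ltW at_) //.
  by rewrite mulr_ge0 ?powR_ge0 // ltW.
by rewrite ler_pM2l // powR_mono // ltW.
Qed.

Lemma slope_defect_bounds (T : R) : exists2 C, 0 < C & forall t, 0 < t <= T ->
  [/\ `|b3 t| <= C * t `^ beta, `|slope t - b2 0| <= C * t `^ beta * t,
      `|defect t| <= C * t `^ beta & `|b0 t| <= C * t ^+ 2].
Proof.
have [C C0 CP] := profile_bounds T.
pose E := `|b2 0| + C * T `^ beta * `|T|.
have E0 : 0 <= E.
  by rewrite addr_ge0 // mulr_ge0 // mulr_ge0 ?powR_ge0 // ltW.
exists (2 * C + E); first by rewrite ltr_wpDr // mulr_gt0.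
have CC : C <= 2 * C + E by lra.
have weaken (X Y : R) : 0 <= Y -> X <= C * Y -> X <= (2 * C + E) * Y.
  by move=> Y0 XY; apply: (le_trans XY); exact: ler_wpM2r.
move=> t /andP[t0 tT]; have [] := CP t; first by rewrite t0.
move=> e3 e2 e1; have t00 := ltW t0.
have es : `|slope t - b2 0| <= C * (t `^ beta * t).
  rewrite slopeE // -[b2 0](mulfK (lt0r_neq0 t0)) -mulrBl normrM normfV.
  by rewrite (gtr0_norm t0) ler_pdivrMr // !mulrA.
have pt := powR_ge0 t beta.
split.
- exact: weaken.
- by rewrite -mulrA; apply: weaken => //; rewrite mulr_ge0.
- rewrite /defect normrM normfV (gtr0_norm t0) ler_pdivrMr // -mulrA.
  have -> : b2 t - slope t = (b2 t - b2 0) - (slope t - b2 0) by ring.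
  apply: (le_trans (ler_normB _ _)); rewrite -mulrA in e2.
  apply: (le_trans (lerD e2 es)).
  have := mulr_ge0 E0 (mulr_ge0 pt t00); move: (t `^ beta * t) => w; lra.
have [a /andP[a0 at_]] := MVT_half_line c0 d0 t0; rewrite b00 subr0 => ->.
rewrite normrM (gtr0_norm t0) expr2 mulrA ler_wpM2r //.
have aT : a <= T by rewrite (le_trans (ltW at_)).
have [|_ _ e1a] := CP a; first by rewrite a0.
have ba : `|b1 a| <= E * a.
  rewrite -[b1 a](subrK (b2 0 * a)); apply: (le_trans (ler_normD _ _)).
  rewrite addrC /E mulrDl normrM (gtr0_norm a0) lerD2l.
  apply: (le_trans e1a); rewrite ler_wpM2r ?(ltW a0) //.
  apply: ler_pM; rewrite ?(ltW a0) //.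
  - by rewrite mulr_ge0 ?powR_ge0 // ltW.
  - by rewrite ler_pM2l // powR_mono // ltW.
  - exact: le_trans (ler_norm _).
apply: (le_trans ba); apply: ler_pM; rewrite ?(ltW a0) ?(ltW at_) //.
by rewrite lerDr mulr_ge0 // ltW.
Qed.

Lemma slope_is_derive (t : R) : 0 < t -> is_derive t 1 slope (defect t).
Proof.
move=> t0; have tn := lt0r_neq0 t0.
have h1 := d1 t0.
have h2 := is_deriveV tn (is_derive_id t 1).
have h3 := is_deriveM h1 h2.
have h4 : is_derive t 1 (b1 * (fun u : R => u^-1)) (defect t).
  apply: (is_derive_eq h3); rewrite /defect slopeE // /GRing.scale /=.
  by field.
apply: near_eq_is_derive h4.
by apply: filterS (lt_nbhsr t0) => s s0; rewrite slopeE.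
Qed.

Lemma defect_is_derive (t : R) : 0 < t ->
  is_derive t 1 defect ((b3 t - 2 * defect t) / t).
Proof.
move=> t0; have tn := lt0r_neq0 t0.
have h1 := is_deriveB (d2 t0) (slope_is_derive t0).
have h2 := is_deriveV tn (is_derive_id t 1).
have h3 := is_deriveM h1 h2.
apply: (is_derive_eq h3); rewrite /GRing.scale /=.
have -> : (b2 - slope) t = t * defect t by rewrite defectK // ltW.
by field.
Qed.

(** Assume [s <= t]. If [t > 2 * s], both values are [O(t `^ beta)] and [t] is
    at most [2 * (t - s)]. Otherwise the derivative is [O(s `^ beta / s)]
    between [s] and [t], and [powR_interpolation] applies. *)
Lemma defect_holder (T : R) : exists2 C, 0 < C & forall s t,
  0 <= s <= T -> 0 <= t <= T -> `|defect s - defect t| <= C * `|s - t| `^ beta.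
Proof.
have [be0 be1] := andP betaP.
have [C C0 CP] := slope_defect_bounds T.
have C60 : 0 < 6 * C by rewrite mulr_gt0.
exists (6 * C) => //.
have ordered (s t : R) : 0 <= s -> s <= t -> t <= T ->
    `|defect s - defect t| <= 6 * C * `|s - t| `^ beta.
  rewrite le_eqVlt => /predU1P[<-|s0] st tT.
    rewrite {1}/defect invr0 mulr0 sub0r normrN sub0r normrN.
    move: st; rewrite le_eqVlt => /predU1P[<-|t0].
      by rewrite {1}/defect invr0 mulr0 normr0 mulr_ge0 ?powR_ge0 // ltW.
    have [|_ _ e _] := CP t; first by rewrite t0.
    rewrite (gtr0_norm t0); apply: (le_trans e).
    by rewrite ler_wpM2r ?powR_ge0 //; lra.
  have t0 := lt_le_trans s0 st.
  have bd u : s <= u -> u <= t -> `|defect u| <= C * u `^ beta.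
    move=> su ut; have [|//] := CP u.
    by rewrite (lt_le_trans s0 su) (le_trans ut).
  have [ts|ts] := leP t (2 * s); last first.
    have h : `|s - t| = t - s by rewrite distrC ger0_norm // subr_ge0.
    have hs : s `^ beta <= `|s - t| `^ beta.
      by apply: powR_mono; rewrite ?h ?(ltW s0) //; lra.
    have ht : t `^ beta <= 2 * `|s - t| `^ beta.
      apply: (@le_trans _ _ ((2 * `|s - t|) `^ beta)).
        by apply: powR_mono; rewrite ?h ?(ltW t0) //; lra.
      rewrite powRM // ler_wpM2r ?powR_ge0 //.
      by apply: ler1_powR; rewrite ?ler1n // ltW.
    have := bd s (lexx _) st; have := bd t st (lexx _).
    have := ler_normB (defect s) (defect t).
    have := ler_wpM2l (ltW C0) hs; have := ler_wpM2l (ltW C0) ht.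
    have : 0 <= C * `|s - t| `^ beta by rewrite mulr_ge0 ?powR_ge0 // ltW.
    lra.
  have [||u] := @MVT_segment R defect (fun u => (b3 u - 2 * defect u) / u) s t st.
  - move=> u; rewrite in_itv /= => /andP[su _].
    by apply: defect_is_derive; exact: lt_trans su.
  - apply: derivable_within_continuous => u; rewrite in_itv /= => /andP[su _].
    by have [] := defect_is_derive (lt_le_trans s0 su).
  rewrite in_itv /= distrC => /andP[su ut] ->.
  have u0 := lt_le_trans s0 su.
  have [|e3 _ ed _] := CP u; first by rewrite u0 (le_trans ut).
  have dP : 0 <= t - s by rewrite subr_ge0.
  have us : u `^ beta <= 2 * s `^ beta.
    apply: (@le_trans _ _ ((2 * s) `^ beta)).
      by apply: powR_mono; [exact: ltW|lra].
    rewrite powRM ?(ltW s0) // ler_wpM2r ?powR_ge0 //.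
    by apply: ler1_powR; rewrite ?ler1n // ltW.
  have num : `|b3 u - 2 * defect u| <= 6 * C * s `^ beta.
    apply: (le_trans (ler_normB _ _)); rewrite normrM ger0_norm //.
    have := ler_wpM2l (ltW C0) us; lra.
  rewrite [`|s - t|]distrC (ger0_norm dP) normrM (ger0_norm dP) normrM normfV.
  rewrite (gtr0_norm u0).
  apply: (@le_trans _ _ (6 * C * (s `^ beta * ((t - s) / s)))).
    have -> : 6 * C * (s `^ beta * ((t - s) / s)) =
        6 * C * s `^ beta / s * (t - s) by ring.
    by rewrite ler_wpM2r // ler_pM ?invr_ge0 ?(ltW u0) // lef_pV2 ?posrE.
  rewrite ler_pM2l // -[leRHS]mul1r; apply: powR_interpolation => //.
  - by rewrite be0 ltW.
  - by rewrite divr_ge0 // ltW.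
  - by rewrite ler_pdivrMr // mul1r; lra.
  - by rewrite mul1r.
move=> s t /andP[s0 sT] /andP[t0 tT]; have [st|ts] := leP s t; first exact: ordered.
by rewrite distrC [`|s - t|]distrC; apply: ordered => //; exact: ltW.
Qed.

(** By the mean value theorem [slope t] is a value of [b2], so the minimum of
    [b2] on the segment bounds both. *)
Lemma slope_lower_bound (T : R) : (forall t, 0 <= t -> 0 < b2 t) -> 0 <= T ->
  exists2 m, 0 < m & forall t, 0 <= t <= T -> m <= b2 t /\ m <= slope t.
Proof.
move=> b2_gt0 T0; have [|m] := @EVT_min R b2 0 T T0.
  apply: continuous_subspaceW c2 => s; rewrite /= !in_itv /= andbT.
  by case/andP.
rewrite in_itv /= => /andP[m0 mT] mP; exists (b2 m); first exact: b2_gt0.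
have mP' s : 0 <= s <= T -> b2 m <= b2 s by move=> sT; apply: mP; rewrite in_itv.
move=> t /andP[t0 tT]; split; first by apply: mP'; rewrite t0.
move: t0; rewrite le_eqVlt => /predU1P[<-|t0].
  by rewrite slope0; apply: mP'; rewrite lexx.
have [a /andP[a0 at_]] := MVT_half_line c1 d1 t0.
rewrite b10 subr0 slopeE // => ->; rewrite mulfK ?gt_eqF //.
by apply: mP'; rewrite (ltW a0) (le_trans (ltW at_)).
Qed.

End Profile.

(** * The norm defined by a positive definite matrix *)

Section Quadratic.
Variables (R : realType) (n : nat) (beta : R) (H : 'rV[R]_n -> R) (M : 'M[R]_n).
Hypothesis hH : H_standing beta H.
Hypothesis MT : M^T = M.
Hypothesis HM : forall x, H x = Num.sqrt (qform M x).
Hypothesis M_ge0 : forall x, 0 <= qform M x.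
Implicit Types x y z : 'rV[R]_n.

(** The i-th coordinate of M x, which is half of the corresponding partial
    derivative of the quadratic form. *)
Definition lin (i : 'I_n) x : R := (x *m M) 0 i.
(** The gradient of H off the origin ([partial_udir]); at the origin the
    quotient takes the default value 0. *)
Definition udir (i : 'I_n) x : R := lin i x / H x.

Lemma sqrH x : H x ^+ 2 = qform M x.
Proof. by rewrite HM sqr_sqrtr. Qed.

Lemma H0 : H 0 = 0. Proof. by case: hH => _ _ _ ->. Qed.

Lemma linD i x y : lin i (x + y) = lin i x + lin i y.
Proof. by rewrite /lin mulmxDl mxE. Qed.

Lemma linZ i (a : R) x : lin i (a *: x) = a * lin i x.
Proof. by rewrite /lin -scalemxAl mxE. Qed.

Lemma linB i x y : lin i (x - y) = lin i x - lin i y.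
Proof. by rewrite linD -[- y]scaleN1r linZ mulN1r. Qed.

Lemma lin_delta i j : lin i (delta_mx 0 j) = M j i.
Proof. by rewrite /lin -rowE mxE. Qed.

Lemma lin0 i : lin i 0 = 0.
Proof. by rewrite /lin mul0mx mxE. Qed.

Lemma udir0 i : udir i 0 = 0.
Proof. by rewrite /udir lin0 mul0r. Qed.

Lemma dotvM_sym x z : dotv (x *m M) z = dotv (z *m M) x.
Proof.
rewrite !dotvE -[LHS](_ : (x *m M *m z^T)^T 0 0 = _); last by rewrite mxE.
by rewrite !trmx_mul trmxK MT mulmxA.
Qed.

Lemma qform_expand x z (s : R) : qform M (z + s *: x) =
  qform M z + 2 * s * dotv (x *m M) z + s ^+ 2 * qform M x.
Proof.
have eT : (z + s *: x)^T = z^T + s *: x^T by rewrite linearD /= linearZ.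
rewrite !qformE dotvE eT.
rewrite !mulmxDl !mulmxDr -!scalemxAl -!scalemxAr.
have : (z *m M *m x^T) 0 0 = (x *m M *m z^T) 0 0 by rewrite -!dotvE dotvM_sym.
have mxD (A A' : 'M[R]_1) : (A + A') 0 0 = A 0 0 + A' 0 0 by rewrite mxE.
have mxZ (a : R) (A : 'M[R]_1) : (a *: A) 0 0 = a * A 0 0 by rewrite mxE.
by rewrite !(mxD, mxZ) => ->; ring.
Qed.

(** The form is nonnegative at the vector [z - (<M x, z> / H x ^+ 2) *: x]. *)
Lemma cauchy_schwarz x z : dotv (x *m M) z ^+ 2 <= H x ^+ 2 * H z ^+ 2.
Proof.
have [->|x0] := eqVneq x 0.
  rewrite mul0mx /dotv big1 ?H0 ?expr0n ?mul0r // => i _.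
  by rewrite mxE mul0r.
have q0 : 0 < H x ^+ 2 by rewrite exprn_gt0 // (H_gt0 hH).
have := M_ge0 (z + (- (dotv (x *m M) z / H x ^+ 2)) *: x).
rewrite qform_expand -!sqrH; move: (dotv _ _) (H z ^+ 2) => c h.
have -> : h + 2 * - (c / H x ^+ 2) * c + (- (c / H x ^+ 2)) ^+ 2 * H x ^+ 2 =
  (H x ^+ 2 * h - c ^+ 2) / H x ^+ 2.
  by field; rewrite (gt_eqF (H_gt0 hH x0)).
by rewrite pmulr_lge0 ?invr_gt0 // subr_ge0.
Qed.

Lemma dotv_ler x z : `|dotv (x *m M) z| <= H x * H z.
Proof.
rewrite -(@ler_pXn2r _ 2) ?nnegrE ?mulr_ge0 ?(H_ge0 hH) //.
by rewrite exprMn real_normK ?num_real // cauchy_schwarz.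
Qed.

Lemma H_triangle x y : H (x + y) <= H x + H y.
Proof.
rewrite -(@ler_pXn2r _ 2) ?nnegrE ?addr_ge0 ?(H_ge0 hH) //.
rewrite sqrH -[y]scale1r qform_expand -!sqrH scale1r.
have := ler_norm (dotv (y *m M) x); have := dotv_ler y x; nra.
Qed.

Lemma HN x : H (- x) = H x.
Proof. by rewrite !HM -scaleN1r qformZ sqrrN expr1n mul1r. Qed.

Lemma H_lipschitz x y : `|H x - H y| <= H (x - y).
Proof.
rewrite ler_norml; apply/andP; split.
  have := H_triangle (y - x) x; rewrite subrK -[X in H X + _]opprB HN; lra.
have := H_triangle (x - y) y; rewrite subrK; lra.
Qed.

Lemma lin_udir i x : lin i x = H x * udir i x.
Proof.
have [->|x0] := eqVneq x 0; first by rewrite lin0 H0 mul0r.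
by rewrite /udir mulrC divfK // gt_eqF // (H_gt0 hH).
Qed.

Lemma lin_dotv i x : lin i x = dotv (x *m M) (delta_mx 0 i).
Proof.
rewrite /dotv (bigD1 i) //= [delta_mx _ _ _ _]mxE !eqxx mulr1.
rewrite big1 ?addr0 // => j ji.
by rewrite [delta_mx _ _ _ _]mxE (negbTE ji) andbF mulr0.
Qed.

Lemma lin_bounded : exists2 E, 0 < E & forall i x, `|lin i x| <= E * H x.
Proof.
exists (1 + \sum_(i < n) H (delta_mx 0 i)).
  by rewrite ltr_pwDl // sumr_ge0 // => i _; exact: (H_ge0 hH).
move=> i x; rewrite lin_dotv (le_trans (dotv_ler _ _)) // mulrC.
rewrite ler_wpM2r ?(H_ge0 hH) // (bigD1 i) //= addrCA lerDl.
by rewrite addr_ge0 // sumr_ge0 // => j _; exact: (H_ge0 hH).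
Qed.

(** The Cauchy-Schwarz inequality for a unit vector in the direction of [x]. *)
Lemma sum_udir_le x z : (\sum_i udir i x * z 0 i) ^+ 2 <= H z ^+ 2.
Proof.
have -> : \sum_i udir i x * z 0 i = dotv (x *m M) z / H x.
  rewrite /dotv mulr_suml; apply: eq_bigr => i _.
  by rewrite /udir /lin mulrAC.
have [->|x0] := eqVneq x 0; first by rewrite H0 invr0 mulr0 expr0n sqr_ge0.
rewrite exprMn exprVn ler_pdivrMr ?exprn_gt0 ?(H_gt0 hH) // mulrC.
exact: cauchy_schwarz.
Qed.

Lemma lin_is_derive i j x : is_derive x (delta_mx 0 j) (lin i) (M j i).
Proof.
apply/is_deriveP; apply: cvg_near_cst; near=> h.
rewrite linD linZ lin_delta addrK mulKf //; near: h; exact: nbhs_dnbhs_neq.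
Unshelve. all: by end_near. Qed.

Lemma qform_is_derive j x :
  is_derive x (delta_mx 0 j) (qform M) (2 * lin j x).
Proof.
apply/is_deriveP.
have : (fun h : R => 2 * lin j x + h * qform M (delta_mx 0 j)) @ 0^' -->
    2 * lin j x + 0 * qform M (delta_mx 0 j).
  apply: cvgD; first exact: cvg_cst.
  by apply: cvgM; [exact: nbhs_dnbhs | exact: cvg_cst].
rewrite mul0r addr0; apply: cvg_trans; apply: near_eq_cvg; near=> h.
have h0 : h != 0 by near: h; exact: nbhs_dnbhs_neq.
by rewrite [h *: _ + x]addrC qform_expand lin_dotv dotvM_sym; field.
Unshelve. all: by end_near. Qed.

(** Both sides come from differentiating [H * H = qform M]. *)
Lemma partial_udir j x : x != 0 -> partial j H x = udir j x.
Proof.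
move=> x0; have Hx := H_gt0 hH x0.
have dH := H_is_derive hH j x0.
have e1 : is_derive x (delta_mx 0 j) (H * H) (2 * lin j x).
  rewrite (_ : H * H = qform M); first exact: qform_is_derive.
  by apply/funext => y; rewrite -sqrH expr2.
have e2 : 2 * lin j x = H x * partial j H x + H x * partial j H x.
  by case: e1 => _ <-; case: (is_deriveM dH dH).
apply: (mulfI (lt0r_neq0 Hx)); rewrite -lin_udir; lra.
Qed.

Lemma H_is_derive_udir j x : x != 0 ->
  is_derive x (delta_mx 0 j) H (udir j x).
Proof. by move=> x0; rewrite -partial_udir //; exact: (H_is_derive hH). Qed.

Lemma udir_is_derive i k x : x != 0 ->
  is_derive x (delta_mx 0 k) (udir i) ((M k i - udir i x * udir k x) / H x).
Proof.
move=> x0; have Hx := H_gt0 hH x0.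
have d0 := is_deriveV (lt0r_neq0 Hx) (is_derive_id (H x) 1).
have d1 := is_derive_compR (H_is_derive_udir k x0) d0.
have d2 := is_deriveM (lin_is_derive i k x) d1.
apply: (is_derive_eq d2); rewrite /GRing.scale /= lin_udir.
by field; rewrite gt_eqF.
Qed.

Lemma H_continuous_of_modulus (f : 'rV[R]_n -> R) x (C b : R) : 0 < b ->
  (forall y, H (x - y) <= 1 -> `|f x - f y| <= C * H (x - y) `^ b) ->
  {for x, continuous f}.
Proof.
have [L L0 LP] := H_bounds hH; apply: (continuous_of_modulus L0) => y.
by rewrite (H_ge0 hH) (LP y).1.
Qed.

Lemma lin_continuous i : continuous (lin i).
Proof.
move=> x; have [E E0 EP] := lin_bounded.
apply: (@H_continuous_of_modulus _ _ E 1) => // y _.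
by rewrite powRr1 ?(H_ge0 hH) // -linB.
Qed.

Lemma udir_continuous i x : x != 0 -> {for x, continuous (udir i)}.
Proof.
move=> x0; apply: (@continuousM _ _ (lin i)); first exact: lin_continuous.
apply: continuousV; first by rewrite gt_eqF // (H_gt0 hH).
exact: (H_partials_continuous hH (s := [::])).
Qed.

(** The regularity of smooth functions homogeneous of degree 0: bounded, and
    Lipschitz at unit distance from the origin, with distances measured by H.
    The denominator [H y] accounts for the rescaling to unit distance. *)
Definition angular (w : 'rV[R]_n -> R) := exists2 A, 0 < A &
  (forall x, x != 0 -> `|w x| <= A) /\
  (forall x y, x != 0 -> y != 0 -> `|w x - w y| <= A * (H (x - y) / H y)).

Lemma angular_udir i : angular (udir i).
Proof.
have [E E0 EP] := lin_bounded.
have bd x : x != 0 -> `|udir i x| <= E.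
  move=> x0; have Hx := H_gt0 hH x0.
  by rewrite /udir normrM normfV (gtr0_norm Hx) ler_pdivrMr.
exists (2 * E); first by rewrite mulr_gt0.
split=> [x x0|x y x0 y0]; first by have := bd x x0; lra.
have Hx := H_gt0 hH x0; have Hy := H_gt0 hH y0.
have -> : udir i x - udir i y =
    (lin i (x - y) + udir i x * (H y - H x)) / H y.
  rewrite linB !lin_udir; field.
  by rewrite gt_eqF.
rewrite normrM normfV (gtr0_norm Hy) mulrA ler_pM2r ?invr_gt0 //.
apply: (le_trans (ler_normD _ _)).
have := EP i (x - y).
have : `|udir i x * (H y - H x)| <= E * H (x - y).
  rewrite normrM; apply: ler_pM => //; first exact: bd.
  by rewrite distrC H_lipschitz.
lra.
Qed.

Lemma angular_scale w (a : R) : angular w -> angular (fun x => a * w x).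
Proof.
move=> [A A0 [w1 w2]]; exists ((`|a| + 1) * A).
  by rewrite mulr_gt0 // ltr_wpDl.
have aa : `|a| <= `|a| + 1 by rewrite lerDl.
split=> [x x0|x y x0 y0]; first by rewrite normrM ler_pM // w1.
by rewrite -mulrBr normrM -mulrA ler_pM // w2.
Qed.

Lemma angularD w w' : angular w -> angular w' -> angular (fun x => w x + w' x).
Proof.
move=> [A A0 [w1 w2]] [A' A'0 [w1' w2']]; exists (A + A'); first exact: addr_gt0.
split=> [x x0|x y x0 y0].
  by apply: (le_trans (ler_normD _ _)); apply: lerD; [exact: w1|exact: w1'].
rewrite opprD addrACA mulrDl; apply: (le_trans (ler_normD _ _)).
by apply: lerD; [exact: w2|exact: w2'].
Qed.

Lemma angularM w w' : angular w -> angular w' -> angular (fun x => w x * w' x).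
Proof.
move=> [A A0 [w1 w2]] [A' A'0 [w1' w2']]; exists (2 * (A * A')).
  by rewrite mulr_gt0 // mulr_gt0.
have AA : 0 < A * A' by rewrite mulr_gt0.
split=> [x x0|x y x0 y0].
  rewrite normrM; apply: (@le_trans _ _ (A * A')); last by lra.
  by apply: ler_pM => //; [exact: w1|exact: w1'].
have -> : w x * w' x - w y * w' y = (w x - w y) * w' x + w y * (w' x - w' y).
  by ring.
apply: (le_trans (ler_normD _ _)); rewrite !normrM.
set t := H (x - y) / H y in w2 w2' *.
have : `|w x - w y| * `|w' x| <= A * t * A'.
  by apply: ler_pM => //; [exact: w2|exact: w1'].
have : `|w y| * `|w' x - w' y| <= A * (A' * t).
  by apply: ler_pM => //; [exact: w1|exact: w2'].
lra.
Qed.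

(** In the difference, the variation of [phi (H x)] is Hoelder and multiplies a
    bounded function, while the variation of [w], which blows up near the
    origin, is multiplied by [phi (H y) = O(H y `^ beta)]; [powR_interpolation]
    handles this second term. *)
Lemma radial_angular_holder (phi : R -> R) (w : 'rV[R]_n -> R) (T C : R) :
  0 < beta < 1 -> 0 < C -> phi 0 = 0 ->
  (forall s t, 0 <= s <= T -> 0 <= t <= T ->
    `|phi s - phi t| <= C * `|s - t| `^ beta) ->
  angular w -> exists2 C', 0 < C' & forall x y, H x <= T -> H y <= T ->
    `|phi (H x) * w x - phi (H y) * w y| <= C' * H (x - y) `^ beta.
Proof.
move=> /andP[be0 be1] C0 phi0 phiP [A A0 [w1 w2]].
have CA : 0 < C * A by rewrite mulr_gt0.
exists (3 * (C * A)); first by rewrite mulr_gt0.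
have one x : H x <= T -> `|phi (H x) * w x| <= C * A * H x `^ beta.
  move=> xT; have [->|x0] := eqVneq x 0.
    by rewrite H0 phi0 mul0r normr0 mulr_ge0 ?powR_ge0 // ltW.
  have := phiP (H x) 0; rewrite phi0 !subr0 (ger0_norm (H_ge0 hH x)) => h.
  rewrite normrM mulrAC; apply: ler_pM => //; last exact: w1.
  have T0 : 0 <= T := le_trans (H_ge0 hH x) xT.
  by apply: h; rewrite ?lexx ?T0 // xT (H_ge0 hH).
move=> x y xT yT.
have d0 : 0 <= H (x - y) `^ beta by rewrite powR_ge0.
have [->|x0] := eqVneq x 0.
  rewrite H0 phi0 mul0r !sub0r normrN HN; apply: (le_trans (one y yT)).
  by rewrite ler_wpM2r ?powR_ge0 //; lra.
have [->|y0] := eqVneq y 0.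
  rewrite H0 phi0 mul0r !subr0; apply: (le_trans (one x xT)).
  by rewrite ler_wpM2r ?powR_ge0 //; lra.
have Hy := H_gt0 hH y0.
have -> : phi (H x) * w x - phi (H y) * w y =
  (phi (H x) - phi (H y)) * w x + phi (H y) * (w x - w y) by ring.
apply: (le_trans (ler_normD _ _)); rewrite !normrM.
have h1 : `|phi (H x) - phi (H y)| * `|w x| <= C * H (x - y) `^ beta * A.
  apply: ler_pM => //; last exact: w1.
  apply: (le_trans (phiP _ _ _ _)); rewrite ?(H_ge0 hH) //.
  rewrite ler_pM2l //; apply: ge0_ler_powR; rewrite ?nnegrE ?(ltW be0) //.
    exact: (H_ge0 hH).
  exact: H_lipschitz.
have h2 : H y `^ beta * `|w x - w y| <= 2 * A * H (x - y) `^ beta.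
  apply: powR_interpolation => //.
  - by rewrite be0 ltW.
  - exact: (H_ge0 hH).
  - by apply: (le_trans (ler_normB _ _)); have := w1 x x0; have := w1 y y0; lra.
  - apply: (le_trans (w2 _ _ x0 y0)); rewrite ler_wpM2r //; last by lra.
    by rewrite divr_ge0 ?(H_ge0 hH).
have h3 : `|phi (H y)| <= C * H y `^ beta.
  have T0 : 0 <= T := le_trans (H_ge0 hH y) yT.
  have := phiP (H y) 0; rewrite phi0 !subr0 (ger0_norm (H_ge0 hH y)).
  by apply; rewrite ?lexx ?T0 // yT (H_ge0 hH).
have h4 : `|phi (H y)| * `|w x - w y| <= C * (2 * A * H (x - y) `^ beta).
  apply: (@le_trans _ _ (C * H y `^ beta * `|w x - w y|)).
    exact: ler_wpM2r.
  by rewrite -mulrA ler_pM2l.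
lra.
Qed.

End Quadratic.

(** * Regularity of the composition at the origin: (B)' implies (B) *)

Section QuadraticComposition.
Variables (R : realType) (n : nat) (beta : R) (H : 'rV[R]_n -> R) (M : 'M[R]_n).
Variables (b0 b1 b2 b3 : R -> R).
Hypothesis hH : H_standing beta H.
Hypothesis MT : M^T = M.
Hypothesis HM : forall x, H x = Num.sqrt (qform M x).
Hypothesis M_ge0 : forall x, 0 <= qform M x.
Hypothesis hb : even_profile beta b0 b1 b2 b3.
Implicit Types x y z : 'rV[R]_n.
Let betaP := profile_exponent hb.
Local Notation SL := (slope b1 b2).
Local Notation DF := (defect b1 b2).
Local Notation lin := (lin M).
Local Notation u := (udir H M).

(** The formulas for the partial derivatives of the composition [b0 \o H]. They
    also make sense at the origin, where [udir] vanishes and [slope 0] is [b2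
    0]. *)
Definition dcomp1 (i : 'I_n) x : R := SL (H x) * lin i x.
Definition dcomp2 (i j : 'I_n) x : R :=
  (b2 (H x) - SL (H x)) * (u i x * u j x) + SL (H x) * M i j.
(** The factor of [defect] collects the derivatives of [slope (H x)] and of the
    two factors [udir]. *)
Definition dcomp3 (k i j : 'I_n) x : R :=
  b3 (H x) * (u k x * u i x * u j x) + DF (H x) *
    (M k i * u j x + M k j * u i x + M i j * u k x
     + -3 * (u k x * u i x * u j x)).

Lemma is_derive_H (f df : R -> R) j x : x != 0 ->
  (forall t : R, 0 < t -> is_derive t 1 f (df t)) ->
  is_derive x (delta_mx 0 j) (f \o H) (df (H x) * u j x).
Proof.
move=> x0 fd; apply: is_derive_compR; last exact: fd (H_gt0 hH x0).
exact: (H_is_derive_udir hH MT HM M_ge0).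
Qed.

Lemma dcomp0_is_derive_away i x : x != 0 ->
  is_derive x (delta_mx 0 i) (b0 \o H) (dcomp1 i x).
Proof.
move=> x0; apply: (is_derive_eq (is_derive_H i x0 (profile_deriv0 hb))).
rewrite /dcomp1 slopeE ?(H_gt0 hH) // (lin_udir M hH).
by field; rewrite gt_eqF // (H_gt0 hH).
Qed.

Lemma dcomp1_is_derive_away i j x : x != 0 ->
  is_derive x (delta_mx 0 j) (dcomp1 i) (dcomp2 j i x).
Proof.
move=> x0; have d1 := is_derive_H j x0 (slope_is_derive hb).
have d2 := is_deriveM d1 (lin_is_derive M i j x).
apply: (is_derive_eq d2); rewrite /dcomp2 /GRing.scale /= -defectK ?(H_ge0 hH) //.
by rewrite (lin_udir M hH) //; ring.
Qed.

Lemma dcomp2_is_derive_away i j k x : x != 0 ->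
  is_derive x (delta_mx 0 k) (dcomp2 i j) (dcomp3 k i j x).
Proof.
move=> x0; have Hx := H_gt0 hH x0.
have ds := is_derive_H k x0 (slope_is_derive hb).
have d2 := is_derive_H k x0 (profile_deriv2 hb).
have du i' := udir_is_derive hH MT HM M_ge0 i' k x0.
have dc := @is_derive_cst R _ R (M i j) x (delta_mx 0 k).
have d := is_deriveD (is_deriveM (is_deriveB d2 ds) (is_deriveM (du i) (du j)))
  (is_deriveM ds dc).
apply: (is_derive_eq d); rewrite /dcomp3 /GRing.scale /=.
rewrite -[(b2 \o H - (SL \o H)) x]/(b2 (H x) - SL (H x)).
rewrite -[(u i * u j) x]/(u i x * u j x).
rewrite -defectK ?(H_ge0 hH) //.
move: (u i x) (u j x) (u k x) (DF _) (b3 _) (SL _) => ui uj uk d' b3' s.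
by field; rewrite gt_eqF.
Qed.

Lemma H_absZ (a : R) x : H (a *: x) = `|a| * H x.
Proof. by rewrite !HM qformZ sqrtrM ?sqr_ge0 // sqrtr_sqr. Qed.

(** A bound by [H y `^ beta * H y] is of higher order than [h], because [H y]
    is proportional to the absolute value of [h] on the axis. *)
Lemma is_derive_at0 (f : 'rV[R]_n -> R) (i : 'I_n) (d C : R) :
  (forall y, y != 0 -> H y <= 1 -> forall h, y = h *: delta_mx 0 i ->
    `|f y - f 0 - h * d| <= C * (H y `^ beta * H y)) ->
  is_derive 0 (delta_mx 0 i) f d.
Proof.
move=> fP; have [be0 _] := andP betaP.
set e := delta_mx 0 i in fP *; have a0 : 0 < H e by rewrite (H_gt0 hH) ?delta_neq0.
apply/is_deriveP; apply/cvgrPdist_le => /= eps eps0.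
have C1 : 0 < `|C * H e| + 1 by rewrite ltr_wpDl.
have e1 : 0 < eps / (`|C * H e| + 1) by rewrite divr_gt0.
(* The extra factor [H e] is the ratio between [H (h *: e)] and [|h|]. *)
pose r := Num.min 1 ((eps / (`|C * H e| + 1)) `^ beta^-1).
have r0 : 0 < r by rewrite lt_min ltr01 powR_gt0.
near=> h.
have h0 : h != 0 by near: h; exact: nbhs_dnbhs_neq.
have : `|h| < r / H e by near: h; apply: dnbhs0_lt; rewrite divr_gt0.
rewrite ltr_pdivlMr // => /ltW; rewrite le_min -H_absZ => /andP[hr1 hr2].
have y0 : h *: e != 0 by rewrite scaler_eq0 negb_or h0 delta_neq0.
have := fP _ y0 hr1 h erefl; rewrite addr0.
have -> : d - h^-1 * (f (h *: e) - f 0) = - (f (h *: e) - f 0 - h * d) / h by field.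
rewrite normrM normfV normrN ler_pdivrMr ?normr_gt0 // => /le_trans; apply.
have -> : C * (H (h *: e) `^ beta * H (h *: e)) =
    H (h *: e) `^ beta * (C * H e) * `|h|.
  by move: (_ `^ _) => w; rewrite H_absZ; ring.
rewrite ler_wpM2r //.
apply: (@le_trans _ _ (H (h *: e) `^ beta * (`|C * H e| + 1))).
  rewrite ler_wpM2l ?powR_ge0 //.
  by have := ler_norm (C * H e); lra.
rewrite -ler_pdivlMr //.
rewrite -[leRHS](powRr1 (ltW e1)) -[X in _ <= _ `^ X](mulVf (lt0r_neq0 be0)) powRrM.
by apply: ge0_ler_powR; rewrite ?nnegrE ?powR_ge0 ?(H_ge0 hH) // ltW.
Unshelve. all: by end_near. Qed.

Lemma le_powR_unit (s : R) : 0 <= s <= 1 -> s <= s `^ beta /\ s `^ beta <= 1.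
Proof.
have [be0 be1] := andP betaP.
move=> /andP[]; rewrite le_eqVlt => /predU1P[<-|s0] s1.
  by rewrite powR0 ?gt_eqF // lexx.
split; first by apply: ger1_powR; rewrite ?s0 // ltW.
rewrite -[leRHS](powRr0 s); apply: ger_powR; rewrite ?s0 //; exact: ltW.
Qed.

Lemma dcomp0_at0 : exists C, forall y, y != 0 -> H y <= 1 ->
  `|b0 (H y)| <= C * (H y `^ beta * H y).
Proof.
have [C C0 CP] := slope_defect_bounds hb 1.
exists C => y y0 y1; have Hy := H_gt0 hH y0.
have [|_ _ _ h] := CP (H y); first by rewrite Hy.
apply: (le_trans h); rewrite ler_pM2l // expr2 ler_pM2r //.
by have [] := @le_powR_unit (H y); rewrite ?(ltW Hy).
Qed.

Lemma dcomp1_at0 i : exists C, forall y, y != 0 -> H y <= 1 ->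
  `|dcomp1 i y - b2 0 * lin i y| <= C * (H y `^ beta * H y).
Proof.
have [C C0 CP] := slope_defect_bounds hb 1.
have [E E0 EP] := lin_bounded hH MT HM M_ge0.
exists (C * E) => y y0 y1; have Hy := H_gt0 hH y0.
have [|_ h _ _] := CP (H y); first by rewrite Hy.
rewrite /dcomp1 -mulrBl normrM.
apply: (@le_trans _ _ (C * H y `^ beta * H y * (E * H y))).
  by apply: ler_pM => //; exact: EP.
have -> : C * H y `^ beta * H y * (E * H y) =
  C * E * (H y `^ beta * H y) * H y by ring.
by rewrite ler_piMr // mulr_ge0 ?mulr_ge0 ?powR_ge0 // ltW.
Qed.

(** The coefficient [b2 - slope] is [t * defect t], hence of order [t `^ beta *
    t], and so is [slope t - b2 0]. *)
Lemma dcomp2_at0 i j : exists C, forall y, y != 0 -> H y <= 1 ->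
  `|dcomp2 i j y - b2 0 * M i j| <= C * (H y `^ beta * H y).
Proof.
have [C C0 CP] := slope_defect_bounds hb 1.
have [E E0 EP] := lin_bounded hH MT HM M_ge0.
exists (C * (E * E + `|M i j|)) => y y0 y1; have Hy := H_gt0 hH y0.
have [|_ h1 h2 _] := CP (H y); first by rewrite Hy.
have uE k : `|u k y| <= E.
  by rewrite /udir normrM normfV (gtr0_norm Hy) ler_pdivrMr.
rewrite /dcomp2 -defectK ?(ltW Hy) // -addrA -mulrBl.
move: (uE i) (uE j) h1 h2.
move: (u i y) (u j y) (SL (H y) - b2 0) (DF (H y)) => ui uj sl de h3 h4 h1 h2.
apply: (le_trans (ler_normD _ _)); rewrite !normrM mulrDr mulrDl (gtr0_norm Hy).
apply: lerD.
  apply: (@le_trans _ _ (H y * (C * H y `^ beta) * (E * E))).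
    apply: ler_pM; rewrite ?mulr_ge0 ?(ltW Hy) ?ler_pM2l //.
    exact: ler_pM.
  by rewrite le_eqVlt; apply/orP; left; apply/eqP; ring.
rewrite [leRHS]mulrAC; apply: ler_wpM2r => //.
by rewrite mulrA.
Qed.

Lemma dcomp0_is_derive i x : is_derive x (delta_mx 0 i) (b0 \o H) (dcomp1 i x).
Proof.
have [->|x0] := eqVneq x 0; last exact: dcomp0_is_derive_away.
have [C CP] := dcomp0_at0; apply: (@is_derive_at0 _ _ _ C) => y y0 y1 h _.
rewrite /dcomp1 lin0 mulr0 mulr0 subr0 /= (H0 hH) (profile_b00 hb) subr0.
exact: CP.
Qed.

Lemma dcomp1_is_derive i j x : is_derive x (delta_mx 0 j) (dcomp1 i) (dcomp2 j i x).
Proof.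
have [->|x0] := eqVneq x 0; last exact: dcomp1_is_derive_away.
have [C CP] := dcomp1_at0 i; apply: (@is_derive_at0 _ _ _ C) => y y0 y1 h yh.
rewrite /dcomp2 {2}/dcomp1 lin0 mulr0 subr0 udir0 mul0r mulr0 add0r (H0 hH) slope0.
by have := CP y y0 y1; rewrite {2}yh linZ lin_delta mulrCA.
Qed.

Lemma dcomp2_0 i j : dcomp2 i j 0 = b2 0 * M i j.
Proof. by rewrite /dcomp2 !udir0 (H0 hH) slope0; ring. Qed.

Lemma dcomp2_is_derive i j k x : is_derive x (delta_mx 0 k) (dcomp2 i j) (dcomp3 k i j x).
Proof.
have [->|x0] := eqVneq x 0; last exact: dcomp2_is_derive_away.
have -> : dcomp3 k i j 0 = 0 by rewrite /dcomp3 !udir0; ring.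
have [C CP] := dcomp2_at0 i j; apply: (@is_derive_at0 _ _ _ C) => y y0 y1 h yh.
rewrite mulr0 subr0 dcomp2_0; exact: CP.
Qed.

Lemma comp_H_continuous (f df : R -> R) x : x != 0 ->
  (forall t : R, 0 < t -> is_derive t 1 f (df t)) ->
  {for x, continuous (f \o H)}.
Proof.
move=> x0 fd; apply: continuous_comp.
  exact: (H_partials_continuous hH (s := [::])).
apply: differentiable_continuous; apply/derivable1_diffP.
by have [] := fd (H x) (H_gt0 hH x0).
Qed.

Lemma continuous_at0 (f : 'rV[R]_n -> R) (C : R) :
  (forall y, y != 0 -> H y <= 1 -> `|f y - f 0| <= C * H y `^ beta) ->
  {for 0, continuous f}.
Proof.
move=> fP; have [be0 _] := andP betaP.
apply: (H_continuous_of_modulus hH be0 (C := C)) => y.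
rewrite sub0r (HN HM) distrC.
have [->|y0] := eqVneq y 0; last exact: fP.
by rewrite subrr normr0 (H0 hH) powR0 ?gt_eqF // mulr0.
Qed.

Lemma dcomp0_continuous : continuous (b0 \o H).
Proof.
move=> x; have [->|x0] := eqVneq x 0; last first.
  exact: comp_H_continuous x0 (profile_deriv0 hb).
have [C CP] := dcomp0_at0; apply: (@continuous_at0 _ `|C|) => y y0 y1.
rewrite /= (H0 hH) (profile_b00 hb) subr0; apply: (le_trans (CP y y0 y1)).
have Hy := H_gt0 hH y0; have [|_ w1] := @le_powR_unit (H y); first by rewrite ltW.
have w0 := powR_ge0 (H y) beta; rewrite mulrCA mulrC.
by rewrite ler_wpM2r // (le_trans (ler_norm _)) // normrM ler_piMr // gtr0_norm.
Qed.

Lemma dcomp1_continuous i : continuous (dcomp1 i).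
Proof.
move=> x; have [->|x0] := eqVneq x 0; last first.
  apply: (@continuousM _ _ (SL \o H)); last exact: (lin_continuous hH MT HM M_ge0).
  exact: comp_H_continuous x0 (slope_is_derive hb).
have [C CP] := dcomp1_at0 i; have [E E0 EP] := lin_bounded hH MT HM M_ge0.
apply: (@continuous_at0 _ (`|C| + `|b2 0| * E)) => y y0 y1.
have Hy := H_gt0 hH y0; have [|w2 w1] := @le_powR_unit (H y); first by rewrite ltW.
rewrite {2}/dcomp1 lin0 mulr0 subr0 -[dcomp1 i y](subrK (b2 0 * lin i y)).
apply: (le_trans (ler_normD _ _)); rewrite mulrDl; apply: lerD.
  apply: (le_trans (CP y y0 y1)); rewrite mulrCA mulrC.
  rewrite ler_wpM2r ?powR_ge0 // (le_trans (ler_norm _)) // normrM ler_piMr //.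
  by rewrite gtr0_norm.
rewrite normrM -mulrA ler_wpM2l //; apply: (le_trans (EP i y)).
by rewrite ler_pM2l.
Qed.

Lemma dcomp2_continuous i j : continuous (dcomp2 i j).
Proof.
move=> x; have [->|x0] := eqVneq x 0; last first.
  have uc k := @udir_continuous _ _ _ _ _ hH MT HM M_ge0 k x x0.
  have sc := comp_H_continuous x0 (slope_is_derive hb).
  have bc := comp_H_continuous x0 (profile_deriv2 hb).
  apply: (@continuousD _ _ _ (fun y => (b2 (H y) - SL (H y)) * (u i y * u j y))
    (fun y => SL (H y) * M i j)).
    apply: (@continuousM _ _ (fun y => b2 (H y) - SL (H y))).
      exact: (@continuousB _ _ _ (b2 \o H)).
    exact: (@continuousM _ _ (u i)).
  apply: (@continuousM _ _ (SL \o H)) => //.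
  exact: cst_continuous.
have [C CP] := dcomp2_at0 i j; apply: (@continuous_at0 _ `|C|) => y y0 y1.
rewrite dcomp2_0; apply: (le_trans (CP y y0 y1)).
have Hy := H_gt0 hH y0; have [|_ w1] := @le_powR_unit (H y); first by rewrite ltW.
have w0 := powR_ge0 (H y) beta; rewrite mulrCA mulrC.
by rewrite ler_wpM2r // (le_trans (ler_norm _)) // normrM ler_piMr // gtr0_norm.
Qed.

Lemma dcomp3_holder k i j (T : R) : exists2 C, 0 < C & forall x y,
  H x <= T -> H y <= T ->
  `|dcomp3 k i j x - dcomp3 k i j y| <= C * H (x - y) `^ beta.
Proof.
have au l : angular H (u l) := angular_udir hH MT HM M_ge0 l.
have [C1 C10 C1P] := profile_holder hb T.
have [C2 C20 C2P] := defect_holder hb T.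
have uuu := angularM (angularM (au k) (au i)) (au j).
have br := angularD (angularD (angularD (angular_scale (M k i) (au j))
  (angular_scale (M k j) (au i))) (angular_scale (M i j) (au k)))
  (angular_scale (-3) uuu).
have [C1' C1'0 h1] := radial_angular_holder hH MT HM M_ge0 betaP C10
  (profile_b30 hb) C1P uuu.
have def0 : DF 0 = 0 by rewrite /defect invr0 mulr0.
have [C2' C2'0 h2] := radial_angular_holder hH MT HM M_ge0 betaP C20 def0 C2P br.
exists (C1' + C2'); first exact: addr_gt0.
move=> x y xT yT; have := lerD (h1 x y xT yT) (h2 x y xT yT).
rewrite -mulrDl; apply: le_trans; apply: le_trans (ler_normD _ _).
by rewrite le_eqVlt; apply/orP; left; apply/eqP; congr (`|_|); rewrite /dcomp3; ring.
Qed.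

Lemma dcomp3_continuous k i j : continuous (dcomp3 k i j).
Proof.
move=> x; have [be0 _] := andP betaP.
have [C C0 CP] := dcomp3_holder k i j (H x + 1).
apply: (H_continuous_of_modulus hH be0 (C := C)) => y h.
apply: CP; first by rewrite lerDl.
have := H_triangle hH MT HM M_ge0 x (y - x).
by rewrite subrKC -[y - x]opprB (HN HM); lra.
Qed.

Lemma partials_comp :
  [/\ forall i, partials [:: i] (b0 \o H) = dcomp1 i,
      forall i j, partials [:: i; j] (b0 \o H) = dcomp2 i j &
      forall i j k, partials [:: i; j; k] (b0 \o H) = dcomp3 i j k].
Proof.
have p1 i : partials [:: i] (b0 \o H) = dcomp1 i.
  by apply/funext => x; have [_] := dcomp0_is_derive i x.
have p2 i j : partials [:: i; j] (b0 \o H) = dcomp2 i j.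
  rewrite -[LHS]/(partial i (partials [:: j] (b0 \o H))) p1.
  by apply/funext => x; have [_] := dcomp1_is_derive j i x.
split=> // i j k.
rewrite -[LHS]/(partial i (partials [:: j; k] (b0 \o H))) p2.
by apply/funext => x; have [_] := dcomp2_is_derive j k i x.
Qed.

(** The explicit formulas hold at every point, so all iterated partial
    derivatives of order at most 3 are known functions. *)
Lemma comp_Ckholder : Ckholder_loc 3 beta setT (b0 \o H).
Proof.
have [p1 p2 p3] := partials_comp; have [L L0 LP] := H_bounds hH.
split; [split|].
- move=> [|i [|j [|k s]]] l x // _ _.
  + by have [] := dcomp0_is_derive l x.
  + by rewrite p1; have [] := dcomp1_is_derive i l x.
  + by rewrite p2; have [] := dcomp2_is_derive i j l x.
- move=> [|i [|j [|k [|? s]]]] x // _ _.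
  + exact: dcomp0_continuous.
  + by rewrite p1; exact: dcomp1_continuous.
  + by rewrite p2; exact: dcomp2_continuous.
  + by rewrite p3; exact: dcomp3_continuous.
move=> [|i [|j [|k [|? s]]]] // _ K Kc _; rewrite p3.
have [T [_ TP]] := compact_bounded Kc.
have KT x : K x -> H x <= L * (T + 1).
  move=> Kx; have [h _] := LP x; apply: (le_trans h); rewrite ler_pM2l //.
  by apply: (TP (T + 1)) => //; rewrite ltrDl.
have [C C0 CP] := dcomp3_holder i j k (L * (T + 1)).
exists (C * L `^ beta) => x y Kx Ky; apply: (le_trans (CP x y (KT x Kx) (KT y Ky))).
have [be0 _] := andP betaP.
rewrite -mulrA ler_pM2l // -powRM ?(ltW L0) //.
have [h _] := LP (x - y).
by apply: ge0_ler_powR; rewrite ?nnegrE ?(H_ge0 hH) ?(ltW be0) ?mulr_ge0 ?(ltW L0).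
Qed.

(** The form equals [b2 p + slope * (<M z, z> - p)] with [p = <u, z> ^+ 2]
    between 0 and [<M z, z>], so a common lower bound of [b2] and [slope]
    bounds it from below. *)
Lemma comp_elliptic (K : R) : (forall t, 0 <= t -> 0 < b2 t) -> 0 < K ->
  exists g : R, 0 < g /\ forall x z, enorm x <= K ->
    g * enorm z ^+ 2 <= qform (hess (b0 \o H) x) z.
Proof.
move=> b2_gt0 K0; have [p1 p2 p3] := partials_comp.
have [L L1 LP] := H_enorm_bounds hH.
have L0 : 0 < L by rewrite (lt_le_trans ltr01).
have [|m m0 mP] := @slope_lower_bound _ _ _ _ _ _ hb (L * K) b2_gt0.
  by rewrite mulr_ge0 // ltW.
exists (m / L ^+ 2); split; first by rewrite divr_gt0 // exprn_gt0.
move=> x z xK.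
have [|mb ms] := mP (H x).
  rewrite (H_ge0 hH) /=; have [h _] := LP x; apply: (le_trans h).
  by rewrite ler_pM2l.
have -> : qform (hess (b0 \o H) x) z =
    (b2 (H x) - SL (H x)) * (\sum_i u i x * z 0 i) ^+ 2 + SL (H x) * qform M z.
  rewrite /qform expr2 mulr_suml !mulr_sumr -big_split /=.
  apply: eq_bigr => i _; rewrite !mulr_sumr -big_split /=.
  apply: eq_bigr => j _.
  have -> : hess (b0 \o H) x i j = dcomp2 i j x by rewrite mxE -p2.
  by rewrite /dcomp2; ring.
rewrite -(sqrH HM M_ge0).
have := sum_udir_le hH MT HM M_ge0 x z; set p := (\sum_i _) ^+ 2 => pH.
have p0 : 0 <= p by rewrite sqr_ge0.
apply: (@le_trans _ _ (m * H z ^+ 2)).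
  rewrite -mulrA ler_pM2l // mulrC ler_pdivrMr ?exprn_gt0 //.
  rewrite mulrC -exprMn ler_pXn2r ?nnegrE ?enorm_ge0 ?mulr_ge0 ?(H_ge0 hH) ?(ltW L0) //.
  by have [] := LP z.
have := ler_wpM2r p0 mb.
have : m * (H z ^+ 2 - p) <= SL (H x) * (H z ^+ 2 - p).
  by rewrite ler_wpM2r // subr_ge0.
lra.
Qed.

End QuadraticComposition.

(** * The two equivalences *)

Lemma even_profile_derive1n_in (R : realType) (beta : R) (B : R -> R) :
  0 < beta < 1 -> Ckholder_loc_in 3 beta `[0, +oo[ B ->
  B 0 = 0 -> derive1_in `[0, +oo[ B 0 = 0 -> derive1n_in `[0, +oo[ 3 B 0 = 0 ->
  even_profile beta B (derive1n_in `[0, +oo[ 1 B) (derive1n_in `[0, +oo[ 2 B)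
    (derive1n_in `[0, +oo[ 3 B).
Proof.
move=> betaP [ck hold] B0 B10 B30.
have d (j : nat) (t : R) : (j < 3)%N -> 0 < t ->
    is_derive t 1 (derive1n_in `[0, +oo[ j B) (derive1n_in `[0, +oo[ j.+1 B t).
  move=> j3 t0; rewrite (derive1n_in_nbhs _ _ (nbhs_nneg t0)).
  apply: near_eq_is_derive (Ck_in_is_derive ck j3 (nbhs_nneg t0)).
  apply: filterS (nbhs_interior (nbhs_nneg t0)) => s sD.
  by rewrite (derive1n_in_nbhs _ _ sD).
have c j : (j <= 3)%N -> {within `[0, +oo[%classic,
    continuous (derive1n_in `[0, +oo[ j B)} by case: ck => _; apply.
split.
- exact: betaP.
- by move=> t; exact: (d 0%N).
- by move=> t; exact: (d 1%N).
- by move=> t; exact: (d 2%N).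
- exact: (c 0%N).
- exact: (c 1%N).
- exact: (c 2%N).
- exact: B0.
- exact: B10.
- exact: B30.
move=> T; have [|C CP] := hold `[0, T]%classic (@segment_compact _ _ _).
  by move=> s; rewrite /= !in_itv /= andbT => /andP[].
exists (`|C| + 1) => [|s t sT tT]; first by rewrite ltr_wpDl.
apply: (le_trans (CP s t _ _)); rewrite /= ?in_itv //.
by rewrite ler_wpM2r ?powR_ge0 // (le_trans (ler_norm _)) // lerDl.
Qed.

Lemma assumption_B'_B (R : realType) (n : nat) (beta : R) (B : R -> R)
    (H : 'rV[R]_n -> R) :
  0 < beta < 1 -> B_standing beta B -> H_standing beta H ->
  assumption_B' beta B H -> assumption_B beta B H.
Proof.
move=> betaP [_ _ B0 B10 Bpos] hH [ckB B30 b20 [M [[MT Mpos] HM]]].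
have hb := even_profile_derive1n_in betaP ckB B0 B10 B30.
have M_ge0 x : 0 <= qform M x.
  have [->|/Mpos/ltW //] := eqVneq x 0.
  rewrite /qform big1 // => i _; rewrite big1 // => j _.
  by rewrite [(0 : 'rV[R]_n) 0 j]mxE mulr0.
split; first exact: (comp_Ckholder hH MT HM M_ge0 hb).
move=> K K0; apply: (comp_elliptic hH MT HM M_ge0 hb _ K0) => t.
rewrite le_eqVlt => /predU1P[<- //|t0].
by rewrite (derive1n_in_nbhs _ _ (nbhs_nneg t0)); have [] := Bpos t t0.
Qed.

Theorem theorem1p5 (R : realType) (n : nat) (beta : R) (B : R -> R)
    (H : 'rV[R]_n -> R) (hn : (2 <= n)%N) (hbeta : 0 < beta < 1)
    (hB : B_standing beta B) (hH : H_standing beta H) :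
  (assumption_A B H <-> assumption_A' B H) /\
  (assumption_B beta B H <-> assumption_B' beta B H).
Proof.
split; split.
- exact: assumption_A_A' hH hB hn.
- exact: assumption_A'_A hH hB.
- exact: assumption_B_B' hH hB hn.
- exact: assumption_B'_B.
Qed.
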